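(* Let $((\mathfrak g,[\cdot,\cdot]_{\mathfrak g}),(V;\rho),T)$ be a Lie-Leibniz triple. With the cochain complexes defined in the context, there is a short exact sequence of cochain complexes $$0\to\Big(\bigoplus_{n\ge0}\mathfrak C^n(T),\partial_T\Big)\xrightarrow{\ \iota\ }\Big(\bigoplus_{n\ge0}\mathfrak C^n(\mathfrak g,\rho,T),\mathcal D\Big)\xrightarrow{\ p\ }\Big(\bigoplus_{n\ge0}\mathfrak C^n(\mathfrak g,\rho),\delta\Big)\to0,$$ where $\iota$ and $p$ are the inclusion and the projection. Consequently, there is a long exact sequence of cohomology groups $$\cdots\to\mathcal H^n(T)\xrightarrow{\mathcal H^n(\iota)}\mathcal H^n_{\rm reg}(\mathfrak g,\rho,T)\xrightarrow{\mathcal H^n(p)}\mathcal H^n(\mathfrak g,\rho)\xrightarrow{c^n}\mathcal H^{n+1}(T)\to\cdots,$$ where the connecting map is $c^n([f])=[\Omega_Tf]$ for all $[f]\in\mathcal H^n(\mathfrak g,\rho)$.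
   Context: A Lie-Leibniz triple $((\mathfrak g,[\cdot,\cdot]_{\mathfrak g}),(V;\rho),T)$ consists of a Lie algebra $\mathfrak g$ over a field, a representation $\rho:\mathfrak g\to\mathfrak{gl}(V)$, and a linear map $T:V\to\mathfrak g$ with $[Tu,Tv]_{\mathfrak g}=T(\rho(Tu)v)$ for all $u,v\in V$. All $0$-cochain spaces are $0$. For $n\ge1$: $\mathfrak C^n(\mathfrak g,\rho)=\mathrm{Hom}(\wedge^n\mathfrak g,\mathfrak g)\oplus\mathrm{Hom}(\wedge^{n-1}\mathfrak g\otimes V,V)$, $\mathfrak C^n(T)=\mathrm{Hom}(\otimes^{n-1}V,\mathfrak g)$ (with $\mathfrak C^1(T)=\mathfrak g$), $\mathfrak C^n(\mathfrak g,\rho,T)=\mathfrak C^n(\mathfrak g,\rho)\oplus\mathfrak C^n(T)$. The operators (raising $n$ by one) are as follows, for $f=(f_{\mathfrak g},f_V)\in\mathfrak C^n(\mathfrak g,\rho)$ and $\theta\in\mathfrak C^n(T)$: $\mathcal D(f,\theta)=(\delta f,\ \partial_T\theta+\Omega_Tf)$, where: (1) $\delta f=((\delta f)_{\mathfrak g},(\delta f)_V)$, $(\delta f)_{\mathfrak g}$ is the Chevalley-Eilenberg coboundary of $f_{\mathfrak g}$ for the adjoint representation, $$(\delta f)_{\mathfrak g}(x_1,\dots,x_{n+1})=\sum_{i=1}^{n+1}(-1)^{i+1}[x_i,f_{\mathfrak g}(x_1,\dots,\hat x_i,\dots,x_{n+1})]_{\mathfrak g}+\sum_{i<j}(-1)^{i+j}f_{\mathfrak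 g}([x_i,x_j]_{\mathfrak g},x_1,\dots,\hat x_i,\dots,\hat x_j,\dots,x_{n+1}),$$ $$\begin{aligned}(\delta f)_V(x_1,\dots,x_n,v)=&\sum_{1\le i<j\le n}(-1)^if_V(x_1,\dots,\hat x_i,\dots,x_{j-1},[x_i,x_j]_{\mathfrak g},x_{j+1},\dots,x_n,v)+(-1)^{n-1}\rho(f_{\mathfrak g}(x_1,\dots,x_n))v\\&+\sum_{i=1}^n(-1)^{i+1}\big(\rho(x_i)f_V(x_1,\dots,\hat x_i,\dots,x_n,v)-f_V(x_1,\dots,\hat x_i,\dots,x_n,\rho(x_i)v)\big).\end{aligned}$$ (2) For $\theta\in\mathrm{Hom}(\otimes^kV,\mathfrak g)$, $k\ge0$, $$\begin{aligned}\partial_T\theta(u_1,\dots,u_{k+1})=&\sum_{i=1}^k(-1)^{i+1}[Tu_i,\theta(u_1,\dots,\hat u_i,\dots,u_{k+1})]_{\mathfrak g}+(-1)^{k+1}[\theta(u_1,\dots,u_k),Tu_{k+1}]_{\mathfrak g}\\&+(-1)^kT(\rho(\theta(u_1,\dots,u_k))u_{k+1})+\sum_{1\le i<j\le k+1}(-1)^i\theta(u_1,\dots,\hat u_i,\dots,u_{j-1},\rho(Tu_i)u_j,u_{j+1},\dots,u_{k+1}).\end{aligned}$$ (3) $\Omega_T(f_{\mathfrak g},f_V)(v_1,\dots,v_n)=(-1)^n\big(f_{\mathfrak g}(Tv_1,\dots,Tv_n)-Tf_V(Tv_1,\dots,Tv_{n-1},v_n)\big)$. $\mathcal H^n(T)$,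 $\mathcal H^n(\mathfrak g,\rho)$, $\mathcal H^n_{\rm reg}(\mathfrak g,\rho,T)$ denote the $n$-th cohomology groups of $(\mathfrak C^\bullet(T),\partial_T)$, $(\mathfrak C^\bullet(\mathfrak g,\rho),\delta)$, $(\mathfrak C^\bullet(\mathfrak g,\rho,T),\mathcal D)$. *)

(* Defs.v *)
From HB Require Import structures.
From mathcomp Require Import all_boot all_order all_algebra.
From mathcomp Require Import all_classical.
From mathcomp Require Import zify.

Set Implicit Arguments.
Unset Strict Implicit.
Unset Printing Implicit Defensive.

Import GRing.Theory.
Import Quotient.

Local Open Scope ring_scope.
Local Open Scope quotient_scope.

(* Submodules of an arbitrary (possibly infinite-dimensional) module, as
   boolean predicates. *)
Record submodule (k : fieldType) (E : lmodType k) := Submodule {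
  submod_pred :> {pred E};
  submodP : submod_closed submod_pred
}.

HB.instance Definition _ (k : fieldType) (E : lmodType k) (S : submodule E) :=
  GRing.isSubmodClosed.Build k E (submod_pred S) (submodP S).

Record subm (k : fieldType) (E : lmodType k) (S : submodule E) : Type :=
  Subm { subm_val :> E; submP : subm_val \in submod_pred S }.

Section SubModule.
Variables (k : fieldType) (E : lmodType k) (S : submodule E).
HB.instance Definition _ := [isSub of subm S for @subm_val k E S].
HB.instance Definition _ := [Choice of subm S by <:].
HB.instance Definition _ := [SubChoice_isSubLmodule of subm S by <:].

Lemma subm_val_linear : linear (@subm_val k E S).
Proof. by []. Qed.
HB.instance Definition _ :=
  GRing.isLinear.Build k (subm S) E _ (@subm_val k E S) subm_val_linear.

Lemma subm_inj : injective (@subm_val k E S).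
Proof. exact: val_inj. Qed.
End SubModule.

Section QuotientModule.
Variables (k : fieldType) (E : lmodType k) (S : submodule E).

Definition lquot : Type := {quot submod_pred S}.

HB.instance Definition _ := GRing.Zmodule.on lquot.

Definition lquot_pi (x : E) : lquot := \pi_{quot submod_pred S} x.

Lemma lquot_piP (x y : E) : lquot_pi x = lquot_pi y <-> x - y \in S.
Proof.
rewrite /lquot_pi; split=> [h|h].
  by rewrite idealrBE; apply/eqP; exact: h.
by apply/eqP; rewrite -(@idealrBE _ (submod_pred S)).
Qed.

Lemma lquot_pi_zmod : zmod_morphism lquot_pi.
Proof. by move=> x y; rewrite /lquot_pi raddfB. Qed.

Lemma lquot_ind (P : lquot -> Prop) : (forall x, P (lquot_pi x)) -> forall q, P q.
Proof. by move=> h q; rewrite -[q]reprK; exact: h. Qed.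

Lemma lquot_piD x y : lquot_pi (x + y) = lquot_pi x + lquot_pi y.
Proof. by rewrite /lquot_pi raddfD. Qed.

Definition lquot_scale (a : k) (q : lquot) : lquot := lquot_pi (a *: repr q).

Lemma lquot_scale_pi a x : lquot_scale a (lquot_pi x) = lquot_pi (a *: x).
Proof.
apply/lquot_piP; rewrite -scalerBr rpredZ //; apply/lquot_piP.
by rewrite /lquot_pi reprK.
Qed.

Lemma lquot_scalerA a b q :
  lquot_scale a (lquot_scale b q) = lquot_scale (a * b) q.
Proof. by elim/lquot_ind: q => x; rewrite !lquot_scale_pi scalerA. Qed.
Lemma lquot_scale1r : left_id 1 lquot_scale.
Proof. by elim/lquot_ind=> x; rewrite lquot_scale_pi scale1r. Qed.
Lemma lquot_scalerDr : right_distributive lquot_scale +%R.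
Proof.
move=> a; elim/lquot_ind=> x; elim/lquot_ind=> y.
by rewrite -lquot_piD !lquot_scale_pi scalerDr lquot_piD.
Qed.
Lemma lquot_scalerDl q : {morph lquot_scale^~ q : a b / a + b}.
Proof.
by move=> a b; elim/lquot_ind: q => x; rewrite !lquot_scale_pi scalerDl lquot_piD.
Qed.

HB.instance Definition _ := GRing.Zmodule_isLmodule.Build k lquot
  lquot_scalerA lquot_scale1r lquot_scalerDr lquot_scalerDl.

Lemma lquot_pi_linear : linear lquot_pi.
Proof. by move=> a x y; rewrite lquot_piD -lquot_scale_pi. Qed.
HB.instance Definition _ := GRing.isLinear.Build k E lquot _ lquot_pi lquot_pi_linear.

End QuotientModule.

Section QuotientMap.
Variables (k : fieldType) (E F : lmodType k).
Variables (S : submodule E) (S' : submodule F) (f : {linear E -> F}).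
Hypothesis fS : {in S, forall x, f x \in S'}.

Definition lquot_map_fun of {in S, forall x, f x \in S'} :=
  fun q : lquot S => lquot_pi S' (f (repr q)).

Lemma lquot_mapE x : lquot_map_fun fS (lquot_pi S x) = lquot_pi S' (f x).
Proof.
apply/lquot_piP; rewrite -linearB; apply: fS; apply/lquot_piP.
by rewrite /lquot_pi reprK.
Qed.

Lemma lquot_map_linear : linear (lquot_map_fun fS).
Proof.
move=> a; elim/lquot_ind=> x; elim/lquot_ind=> y.
by rewrite -linearP !lquot_mapE !linearP.
Qed.
HB.instance Definition _ :=
  GRing.isLinear.Build k _ _ _ (lquot_map_fun fS) lquot_map_linear.

Definition lquot_map : {linear lquot S -> lquot S'} := lquot_map_fun fS.

End QuotientMap.

(* The equation d o d = 0 is kept as the separate property [is_complex].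
   [cohomology] divides the cocycles by those cocycles that are coboundaries,
   which is the usual ker/im as soon as [is_complex] holds. *)
Record cochain_seq (k : fieldType) := CochainSeq {
  cochain :> nat -> lmodType k;
  cdiff : forall n, {linear cochain n -> cochain n.+1}
}.
Arguments cdiff {k} c n.

Definition is_complex (k : fieldType) (C : cochain_seq k) : Prop :=
  forall n (x : C n), cdiff C n.+1 (cdiff C n x) = 0.

Definition coboundary (k : fieldType) (C : cochain_seq k) (n : nat) : C n -> Prop :=
  match n return C n -> Prop with
  | 0 => fun x => x = 0
  | m.+1 => fun x => exists y : C m, cdiff C m y = x
  end.

Lemma coboundary0 (k : fieldType) (C : cochain_seq k) n : coboundary (0 : C n).
Proof. by case: n => //= m; exists 0; rewrite linear0. Qed.

Lemma coboundaryD (k : fieldType) (C : cochain_seq k) n a (x y : C n) :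
  coboundary x -> coboundary y -> coboundary (a *: x + y).
Proof.
case: n x y => [x y -> ->|m x y [u <-] [v <-]]; first by rewrite /= scaler0 addr0.
by exists (a *: u + v); rewrite linearP.
Qed.

Section Cohomology.
Variables (k : fieldType) (C : cochain_seq k) (n : nat).

Fact cocycle_closed : submod_closed (fun x : C n => cdiff C n x == 0).
Proof.
split; first by rewrite unfold_in linear0.
by move=> a x y; rewrite !unfold_in linearP => /eqP-> /eqP->; rewrite scaler0 addr0.
Qed.

Definition cocycle : Type := subm (Submodule cocycle_closed).
HB.instance Definition _ := GRing.Lmodule.on cocycle.

Fact coboundary_closed : submod_closed (fun z : cocycle => `[< coboundary (subm_val z) >]).
Proof.
split; first by rewrite unfold_in; apply/asboolP; exact: coboundary0.
move=> a x y; rewrite !unfold_in => /asboolP hx /asboolP hy; apply/asboolP.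
by rewrite linearP; exact: coboundaryD.
Qed.

Definition cohomology : Type := lquot (Submodule coboundary_closed).
HB.instance Definition _ := GRing.Lmodule.on cohomology.

Definition coh_class : {linear cocycle -> cohomology} :=
  lquot_pi (Submodule coboundary_closed).

End Cohomology.

Record cochain_map (k : fieldType) (A B : cochain_seq k) := CochainMap {
  cmap :> forall n, {linear A n -> B n};
  cmapP : forall n (x : A n), cmap n.+1 (cdiff A n x) = cdiff B n (cmap n x)
}.

Lemma cmap_coboundary (k : fieldType) (A B : cochain_seq k)
  (phi : cochain_map A B) n (x : A n) : coboundary x -> coboundary (phi n x).
Proof.
case: n x => [x ->|m x [y <-]] /=; first by rewrite linear0.
by exists (phi m y); rewrite cmapP.
Qed.

Section CohomologyMap.
Variables (k : fieldType) (A B : cochain_seq k) (phi : cochain_map A B) (n : nat).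

Fact cocycle_map_proof (z : cocycle A n) :
  phi n (subm_val z) \in submod_pred (Submodule (@cocycle_closed k B n)).
Proof.
have := submP z; rewrite !unfold_in -cmapP => /eqP->.
by rewrite linear0.
Qed.

Definition cocycle_map_fun (z : cocycle A n) : cocycle B n :=
  Subm (cocycle_map_proof z).

Fact cocycle_map_linear : linear cocycle_map_fun.
Proof. by move=> a x y; apply: val_inj; rewrite /= linearP. Qed.
HB.instance Definition _ :=
  GRing.isLinear.Build k _ _ _ cocycle_map_fun cocycle_map_linear.

Definition cocycle_map : {linear cocycle A n -> cocycle B n} := cocycle_map_fun.

Fact cocycle_map_coboundary :
  {in submod_pred (Submodule (@coboundary_closed k A n)), forall z,
    cocycle_map z \in submod_pred (Submodule (@coboundary_closed k B n))}.
Proof.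
move=> z; rewrite !unfold_in => /asboolP hz; apply/asboolP.
exact: cmap_coboundary.
Qed.

Definition cohomology_map : {linear cohomology A n -> cohomology B n} :=
  lquot_map cocycle_map_coboundary.

End CohomologyMap.

Section Exactness.
Variable k : fieldType.

Definition exact_at (X Y Z : lmodType k) (f : {linear X -> Y}) (h : {linear Y -> Z}) :=
  forall y, h y = 0 <-> exists x, f x = y.

Definition short_exact (A B C : cochain_seq k)
    (i : cochain_map A B) (p : cochain_map B C) : Prop :=
  forall n, [/\ injective (i n), exact_at (i n) (p n)
              & forall z, exists y, p n y = z].

Variables (A B C : cochain_seq k) (i : cochain_map A B) (p : cochain_map B C).

(* The defining property of the connecting homomorphism: lift a cocycle along
   p, apply the differential, and pull the result back along i. *)
Definition connecting (c : forall n, {linear cohomology C n -> cohomology A n.+1}) :=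
  forall n (z : cocycle C n) (y : B n) (x : cocycle A n.+1),
    p n y = subm_val z -> i n.+1 (subm_val x) = cdiff B n y ->
    c n (coh_class C n z) = coh_class A n.+1 x.

(* Complexes start in degree 0, so the sequence starts with
   0 -> H^0(A) -> H^0(B). *)
Definition long_exact (c : forall n, {linear cohomology C n -> cohomology A n.+1}) :=
  injective (cohomology_map i 0) /\
  forall n, [/\ exact_at (cohomology_map i n) (cohomology_map p n),
                exact_at (cohomology_map p n) (c n)
              & exact_at (c n) (cohomology_map i n.+1)].

End Exactness.

Section Families.
Variable X : Type.

Definition upd n (x : 'I_n -> X) (i : 'I_n) (u : X) : 'I_n -> X :=
  fun j => if j == i then u else x j.

Definition omit n (i : 'I_n.+1) (x : 'I_n.+1 -> X) : 'I_n -> X :=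
  fun l => x (lift i l).

(* For i < j, the map l |-> bump j (bump i l) enumerates increasingly the
   indices other than i and j. *)
Definition omit2 n (i j : 'I_n.+2) (x : 'I_n.+2 -> X) : 'I_n -> X :=
  fun l => x (inord (bump j (bump i l))).

Definition fcons n (u : X) (x : 'I_n -> X) : 'I_n.+1 -> X :=
  fun l => if unlift ord0 l is Some l' then x l' else u.

Lemma upd_eq n (x : 'I_n -> X) i u : upd x i u i = u.
Proof. by rewrite /upd eqxx. Qed.

Lemma upd_neq n (x : 'I_n -> X) i u j : j != i -> upd x i u j = x j.
Proof. by rewrite /upd => /negPf->. Qed.

Lemma upd_id n (x : 'I_n -> X) i : upd x i (x i) = x.
Proof. by apply/funext => j; rewrite /upd; case: eqP => [->|]. Qed.

Lemma upd_upd n (x : 'I_n -> X) i u w : upd (upd x i u) i w = upd x i w.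
Proof. by apply/funext => j; rewrite /upd; case: eqP. Qed.

Lemma updC n (x : 'I_n -> X) i j u w : i != j ->
  upd (upd x i u) j w = upd (upd x j w) i u.
Proof.
move=> ij; apply/funext => l; rewrite /upd.
by case: (eqVneq l j) => // ->; rewrite eq_sym (negPf ij).
Qed.

Lemma omit_upd_eq n (x : 'I_n.+1 -> X) i u : omit i (upd x i u) = omit i x.
Proof. by apply/funext => l; rewrite /omit upd_neq // eq_sym neq_lift. Qed.

Lemma omit_upd n (x : 'I_n.+1 -> X) i a u :
  omit i (upd x (lift i a) u) = upd (omit i x) a u.
Proof. by apply/funext => l; rewrite /omit /upd (inj_eq lift_inj). Qed.

Lemma omit2_val n (i j : 'I_n.+2) (l : 'I_n) : (i < j)%N ->
  (bump j (bump i l) < n.+2)%N.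
Proof. move=> ij; rewrite /bump; case: l j ij => /= l hl [j hj] /=; lia. Qed.

Lemma omit2_upd n (x : 'I_n.+2 -> X) (i j b : 'I_n.+2) : (i < j)%N ->
  b != i -> b != j ->
  exists a : 'I_n, forall u, omit2 i j (upd x b u) = upd (omit2 i j x) a u.
Proof.
move=> ij bi bj.
have hc : (unbump i (unbump j b) < n)%N.
  move: bi bj; rewrite -!val_eqE /= /unbump.
  case: i j b ij => [i hi] [j hj] [b hb] /=; lia.
exists (Ordinal hc) => u; apply/funext => l; rewrite /omit2 /upd.
have := omit2_val l ij => hl.
congr (if _ then _ else _); rewrite -!val_eqE /= inordK //.
move: bi bj; rewrite -!val_eqE /= /unbump /bump.
case: i j b ij {hc hl} => [i hi] [j hj] [b hb] /=; case: l => l hl /=; lia.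
Qed.

Lemma omit2_upd_eq n (x : 'I_n.+2 -> X) (i j b : 'I_n.+2) u : (i < j)%N ->
  (b == i) || (b == j) -> omit2 i j (upd x b u) = omit2 i j x.
Proof.
move=> ij bij; apply/funext => l; rewrite /omit2 upd_neq //.
have hl := omit2_val l ij; rewrite -val_eqE /= inordK //.
move: bij; rewrite -!val_eqE /= /bump; lia.
Qed.

Lemma fcons_upd n (x : 'I_n -> X) a u w :
  fcons w (upd x a u) = upd (fcons w x) (lift ord0 a) u.
Proof.
apply/funext => l; rewrite /fcons /upd.
case: unliftP => [l' ->|->]; first by rewrite (inj_eq lift_inj).
by rewrite (negPf (neq_lift _ _)).
Qed.

Lemma fcons_head n (x : 'I_n -> X) u w : fcons u x = upd (fcons w x) ord0 u.
Proof.
apply/funext => l; rewrite /fcons /upd.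
by case: unliftP => [l' ->|->]; rewrite ?eqxx // eq_sym (negPf (neq_lift _ _)).
Qed.

(* Two adjacent equal entries a, b = a + 1. *)
Lemma omit_adj n (x : 'I_n.+1 -> X) (a b : 'I_n.+1) : b = a.+1 :> nat ->
  x a = x b -> omit a x = omit b x.
Proof.
move=> ab xab; apply/funext => l; rewrite /omit.
case: (eqVneq (nat_of_ord l) (nat_of_ord a)) => la.
  have -> : lift a l = b by apply: val_inj; rewrite /= ab /bump; lia.
  have -> // : lift b l = a by apply: val_inj; rewrite /= /bump; lia.
by congr x; apply: val_inj; rewrite /= /bump; move: la; rewrite ab /=; lia.
Qed.

Lemma omit2_adjl n (x : 'I_n.+2 -> X) (a b j : 'I_n.+2) : b = a.+1 :> nat ->
  (b < j)%N -> x a = x b -> omit2 a j x = omit2 b j x.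
Proof.
move=> ab bj xab; apply/funext => l; rewrite /omit2.
case: (eqVneq (nat_of_ord l) (nat_of_ord a)) => la.
  rewrite (_ : inord _ = b).
    by rewrite (_ : inord _ = a) //; apply: val_inj;
       rewrite /= inordK ?omit2_val // /bump; lia.
  by apply: val_inj; rewrite /= inordK ?omit2_val //; [rewrite /bump|]; lia.
by congr (x (inord _)); rewrite /bump; move: la => /=; lia.
Qed.

Lemma omit2_adjr n (x : 'I_n.+2 -> X) (a b i : 'I_n.+2) : b = a.+1 :> nat ->
  (i < a)%N -> x a = x b -> omit2 i a x = omit2 i b x.
Proof.
move=> ab ia xab; apply/funext => l; rewrite /omit2.
case: (eqVneq (bump i l) (nat_of_ord a)) => la.
  rewrite (_ : inord _ = b).
    by rewrite (_ : inord _ = a) //; apply: val_inj;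
       rewrite /= inordK ?omit2_val //; move: la; rewrite /bump /=; lia.
  by apply: val_inj; rewrite /= inordK ?omit2_val //; move: la; rewrite /bump /=; lia.
by congr (x (inord _)); move: la; rewrite /bump /=; lia.
Qed.

End Families.

Section LinearClosure.
Variables (k : fieldType).
Implicit Types U V W : lmodType k.

Lemma lin_id U : linear (fun u : U => u). Proof. by []. Qed.

Lemma lin0 U V : linear (fun _ : U => 0 : V).
Proof. by move=> a u v; rewrite scaler0 addr0. Qed.

Lemma linD U V (f h : U -> V) : linear f -> linear h -> linear (fun u => f u + h u).
Proof. by move=> hf hh a u v; rewrite hf hh scalerDr addrACA. Qed.

Lemma linZ U V c (f : U -> V) : linear f -> linear (fun u => c *: f u).
Proof. by move=> hf a u v; rewrite hf scalerDr !scalerA mulrC. Qed.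

Lemma linN U V (f : U -> V) : linear f -> linear (fun u => - f u).
Proof. by move=> hf a u v; rewrite hf opprD scalerN. Qed.

Lemma linB U V (f h : U -> V) : linear f -> linear h -> linear (fun u => f u - h u).
Proof. by move=> hf hh; apply: linD => //; exact: linN. Qed.

Lemma linC U V W (f : V -> W) (h : U -> V) :
  linear f -> linear h -> linear (fun u => f (h u)).
Proof. by move=> hf hh a u v; rewrite hh hf. Qed.

Lemma lin_sum U V (I : finType) (P : pred I) (f : I -> U -> V) :
  (forall i, P i -> linear (f i)) -> linear (fun u => \sum_(i | P i) f i u).
Proof.
move=> hf a u v; rewrite scaler_sumr -big_split /=.
by apply: eq_bigr => i Pi; rewrite hf.
Qed.

Lemma lin_zero U V (f : U -> V) : linear f -> f 0 = 0.
Proof. by move=> hf; have := hf (-1) 0 0; rewrite scaler0 addr0 scaleN1r addNr. Qed.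

Lemma linDe U V (f : U -> V) u v : linear f -> f (u + v) = f u + f v.
Proof. by move=> hf; have := hf 1 u v; rewrite !scale1r. Qed.

End LinearClosure.

Section Multilinear.
Variables (k : fieldType) (X Y : lmodType k).

Definition multilinear n (f : ('I_n -> X) -> Y) : Prop :=
  forall x i, linear (fun u => f (upd x i u)).

Definition alternating n (f : ('I_n -> X) -> Y) : Prop :=
  forall x i j, i != j -> x i = x j -> f x = 0.

Lemma ml0 n (f : ('I_n -> X) -> Y) x i : multilinear f -> x i = 0 -> f x = 0.
Proof. by move=> hf xi; rewrite -(upd_id x i) xi; exact: lin_zero (hf x i). Qed.

Lemma ml_omit n (f : ('I_n -> X) -> Y) (x : 'I_n.+1 -> X) i b :
  multilinear f -> b != i -> linear (fun u => f (omit i (upd x b u))).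
Proof.
move=> hf; case: (unliftP i b) => [a -> _|->]; last by rewrite eqxx.
by move=> c u v; rewrite !omit_upd; exact: hf.
Qed.

Lemma ml_fcons_head n (f : ('I_n.+1 -> X) -> Y) (x : 'I_n -> X) :
  multilinear f -> linear (fun u => f (fcons u x)).
Proof.
move=> hf.
suff -> : (fun u => f (fcons u x)) = (fun u => f (upd (fcons 0 x) ord0 u)) by exact: hf.
by apply/funext => u; congr f; exact: fcons_head.
Qed.

Lemma ml_fcons n (f : ('I_n.+1 -> X) -> Y) (x : 'I_n -> X) w a :
  multilinear f -> linear (fun u => f (fcons w (upd x a u))).
Proof. by move=> hf c u v; rewrite !fcons_upd; exact: hf. Qed.

Lemma ml_omit0 n (f : ('I_n -> X) -> Y) (x : 'I_n.+1 -> X) i b :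
  multilinear f -> b != i -> x b = 0 -> f (omit i x) = 0.
Proof.
move=> hf bi xb; rewrite -(upd_id x b) xb.
exact: lin_zero (ml_omit x hf bi).
Qed.

(* Terms of the shape f(.., x_i omitted, .., B x_i x_j, ..). *)
Lemma ml_insert n (f : ('I_n -> X) -> Y) (B : X -> X -> X) x (i j b : 'I_n.+1) :
  (forall w, linear (B w)) -> (forall w, linear (B^~ w)) ->
  multilinear f -> (i < j)%N ->
  linear (fun u => f (omit i
    (upd (upd x b u) j (B (upd x b u i) (upd x b u j))))).
Proof.
move=> Bl Br hf ij.
have ji : j != i by rewrite -val_eqE /= neq_ltn ij orbT.
have ij' : i != j by rewrite eq_sym.
case: (eqVneq b i) => [->|bi].
  move=> a u v; rewrite !upd_eq !(upd_neq _ _ ji) !(updC _ _ _ ij') !omit_upd_eq.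
  exact: (linC (ml_omit x hf ji) (Br _)).
case: (eqVneq b j) => [->|bj].
  move=> a u v; rewrite !upd_eq !(upd_neq _ _ ij') !upd_upd.
  exact: (linC (ml_omit x hf ji) (Bl _)).
have ib : i != b by rewrite eq_sym.
have jb : j != b by rewrite eq_sym.
move=> a u v; rewrite !(upd_neq _ _ ib) !(upd_neq _ _ jb) !(updC _ _ _ bj).
exact: (ml_omit _ hf bi).
Qed.

Lemma ml_anti n (f : ('I_n -> X) -> Y) x i j u w :
  multilinear f -> i != j -> (forall v, f (upd (upd x i v) j v) = 0) ->
  f (upd (upd x i u) j w) + f (upd (upd x i w) j u) = 0.
Proof.
move=> hf ij h; have := h (u + w).
rewrite (linDe u w (hf (upd x i (u + w)) j)).
rewrite (updC x (u + w) u ij) (updC x (u + w) w ij).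
rewrite (linDe u w (hf (upd x j u) i)) (linDe u w (hf (upd x j w) i)).
rewrite -!(updC x _ _ ij) !h.
by rewrite add0r addr0 addrC.
Qed.

Lemma alt_anti n (f : ('I_n -> X) -> Y) x i j u w :
  multilinear f -> alternating f -> i != j ->
  f (upd (upd x i u) j w) + f (upd (upd x i w) j u) = 0.
Proof.
move=> hf af ij; apply: ml_anti => // v.
by apply: (af _ i j) => //; rewrite upd_eq upd_neq // upd_eq.
Qed.

Lemma alt_omit n (f : ('I_n -> X) -> Y) (x : 'I_n.+1 -> X) i a b :
  alternating f -> a != b -> i != a -> i != b -> x a = x b -> f (omit i x) = 0.
Proof.
move=> af ab /unlift_some[a' ea _] /unlift_some[b' eb _] xab.
apply: (af _ a' b'); last by rewrite /omit -ea -eb.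
by apply: contraNneq ab => e; rewrite ea eb e.
Qed.

Lemma alt_omit_anti n (f : ('I_n -> X) -> Y) (x : 'I_n.+1 -> X) i a b u w :
  multilinear f -> alternating f -> a != b -> i != a -> i != b ->
  f (omit i (upd (upd x a u) b w)) + f (omit i (upd (upd x a w) b u)) = 0.
Proof.
move=> hf af ab /unlift_some[a' ea _] /unlift_some[b' eb _].
rewrite ea eb !omit_upd; apply: alt_anti => //.
by apply: contraNneq ab => e; rewrite ea eb e.
Qed.

Lemma alt_fcons2 n (f : ('I_n.+1 -> X) -> Y) (x : 'I_n.+2 -> X) w (i j a b : 'I_n.+2) :
  alternating f -> (i < j)%N -> a != b -> i != a -> i != b -> j != a -> j != b ->
  x a = x b -> f (fcons w (omit2 i j x)) = 0.
Proof.
move=> af ij ab ia ib ja jb xab.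
have H c : i != c -> j != c -> exists c' : 'I_n, bump j (bump i c') = c.
  move=> ic jc.
  have hc : (unbump i (unbump j c) < n)%N.
    move: ic jc; rewrite -!val_eqE /= /unbump.
    case: i j c ij {ia ib ja jb} => [i hi] [j hj] [c hc] /=; lia.
  exists (Ordinal hc); move: ic jc; rewrite -!val_eqE /= /unbump /bump.
  case: i j c ij {ia ib ja jb hc} => [i hi] [j hj] [c hc] /=; lia.
have [a' ea] := H a ia ja; have [b' eb] := H b ib jb.
apply: (af _ (lift ord0 a') (lift ord0 b')).
  rewrite (inj_eq lift_inj); apply: contraNneq ab => e.
  by rewrite -val_eqE /= -ea -eb e.
by rewrite /fcons !liftK /omit2 ea eb !inord_val.
Qed.

Lemma alt_adjacent n (f : ('I_n -> X) -> Y) : multilinear f ->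
  (forall x (a b : 'I_n), b = a.+1 :> nat -> x a = x b -> f x = 0) ->
  alternating f.
Proof.
move=> hf hadj.
have hswap x (a b : 'I_n) u w : b = a.+1 :> nat ->
    f (upd (upd x a u) b w) + f (upd (upd x a w) b u) = 0.
  move=> ab; have nab : a != b by rewrite -val_eqE /= ab; lia.
  apply: ml_anti => // v.
  by apply: (hadj _ a b) => //; rewrite upd_eq upd_neq // upd_eq.
suff H d x (a b : 'I_n) : b = (a + d).+1 :> nat -> x a = x b -> f x = 0.
  move=> x i j ij xij; case: (ltngtP i j) => [h|h|h].
  - by apply: (H (j - i).-1 x i j) => //; lia.
  - by apply: (H (i - j).-1 x j i) => //; lia.
  - by move/val_inj: h ij => ->; rewrite eqxx.
elim: d x b => [|d IH] x b hb xab; first by apply: (hadj x a b) => //; lia.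
have hc : (b.-1 < n)%N by have := ltn_ord b; lia.
pose c := Ordinal hc.
have cb : c != b by rewrite -val_eqE /=; lia.
have bc : b != c by rewrite eq_sym.
have ac : a != c by rewrite -val_eqE /=; lia.
have ab : a != b by rewrite -val_eqE /=; lia.
have e : b = c.+1 :> nat by rewrite /=; lia.
have := hswap x c b (x c) (x b) e.
rewrite !upd_id [X in _ + X](IH _ c) ?addr0 //=; first lia.
by rewrite (upd_neq _ _ ab) (upd_neq _ _ ac) (upd_neq _ _ cb) upd_eq.
Qed.

End Multilinear.

Section HomSpaces.
Variables (k : fieldType) (X Y Z : lmodType k).

Lemma multilinear_closed n :
  submod_closed (fun f : ('I_n -> X) -> Y => `[< multilinear f >]).
Proof.
split; first by rewrite unfold_in; apply/asboolP => x i; exact: lin0.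
move=> a f h; rewrite !unfold_in => /asboolP hf /asboolP hh; apply/asboolP => x i.
by apply: linD (hh x i); exact: linZ.
Qed.

Lemma alternating_closed n :
  submod_closed (fun f : ('I_n -> X) -> Y => `[< multilinear f /\ alternating f >]).
Proof.
split.
  by rewrite unfold_in; apply/asboolP; split => // x i; exact: lin0.
move=> a f h; rewrite !unfold_in => /asboolP[hf af] /asboolP[hh ah].
apply/asboolP; split => [x i|x i j ij xij].
  by apply: linD (hh x i); exact: linZ.
have -> : (a *: f + h) x = a *: f x + h x by [].
by rewrite (af x i j) // (ah x i j) // scaler0 addr0.
Qed.

Definition alt_lin n (f : ('I_n -> X) -> Z -> Y) : Prop :=
  [/\ forall v, multilinear (f^~ v), forall v, alternating (f^~ v)
    & forall x, linear (f x)].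

Lemma alt_lin_closed n :
  submod_closed (fun f : ('I_n -> X) -> Z -> Y => `[< alt_lin f >]).
Proof.
split.
  by rewrite unfold_in; apply/asboolP; split => // [v x i|x]; exact: lin0.
move=> a f h; rewrite !unfold_in => /asboolP[hf af lf] /asboolP[hh ah lh].
have E x v : (a *: f + h) x v = a *: f x v + h x v by [].
apply/asboolP; split => [v x i|v x i j ij xij|x].
- by apply: linD (hh v x i); apply: linZ; exact: hf.
- by rewrite E (af v x i j) // (ah v x i j) // scaler0 addr0.
- by apply: linD (lh x); exact: linZ.
Qed.

(* Hom(X (x) ... (x) X, Y), n factors *)
Definition tensorHom n : Type := subm (Submodule (multilinear_closed n)).
(* Hom(/\^n X, Y) *)
Definition altHom n : Type := subm (Submodule (alternating_closed n)).
(* Hom(/\^n X (x) Z, Y) *)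
Definition altTensorHom n : Type := subm (Submodule (alt_lin_closed n)).

HB.instance Definition _ n := GRing.Lmodule.on (tensorHom n).
HB.instance Definition _ n := GRing.Lmodule.on (altHom n).
HB.instance Definition _ n := GRing.Lmodule.on (altTensorHom n).

Lemma tensorHomP n (f : tensorHom n) : multilinear (subm_val f).
Proof. by have := submP f; rewrite unfold_in => /asboolP. Qed.
Lemma altHomP n (f : altHom n) :
  multilinear (subm_val f) /\ alternating (subm_val f).
Proof. by have := submP f; rewrite unfold_in => /asboolP. Qed.
Lemma altTensorHomP n (f : altTensorHom n) : alt_lin (subm_val f).
Proof. by have := submP f; rewrite unfold_in => /asboolP. Qed.

Definition mkTensorHom n (f : ('I_n -> X) -> Y) (hf : multilinear f) : tensorHom n :=
  @Subm _ _ (Submodule (multilinear_closed n)) f (asboolT hf).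
Definition mkAltHom n (f : ('I_n -> X) -> Y) (hf : multilinear f /\ alternating f) :
    altHom n :=
  @Subm _ _ (Submodule (alternating_closed n)) f (asboolT hf).
Definition mkAltTensorHom n (f : ('I_n -> X) -> Z -> Y) (hf : alt_lin f) :
    altTensorHom n :=
  @Subm _ _ (Submodule (alt_lin_closed n)) f (asboolT hf).

End HomSpaces.

HB.mixin Record Lmodule_isLie (k : fieldType) g of GRing.Lmodule k g := {
  lieb : g -> g -> g;
  lieb_linearl : forall y, linear (lieb^~ y);
  lieb_linearr : forall x, linear (lieb x);
  liebxx : forall x, lieb x x = 0;
  lieb_jacobi : forall x y z,
    lieb x (lieb y z) + lieb y (lieb z x) + lieb z (lieb x y) = 0
}.

#[short(type="lieAlgType")]
HB.structure Definition LieAlgebra (k : fieldType) :=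
  {g of Lmodule_isLie k g & GRing.Lmodule k g}.

Record lie_rep (k : fieldType) (g : lieAlgType k) (V : lmodType k) := LieRep {
  rep :> g -> V -> V;
  rep_linearl : forall v, linear (rep^~ v);
  rep_linearr : forall x, linear (rep x);
  rep_lieb : forall x y v, rep (lieb x y) v = rep x (rep y v) - rep y (rep x v)
}.

Definition is_lie_leibniz_triple (k : fieldType) (g : lieAlgType k) (V : lmodType k)
    (rho : lie_rep g V) (T : {linear V -> g}) : Prop :=
  forall u v, lieb (T u) (T v) = T (rho (T u) v).

(* Indices run from 0, so that (-1)^(i+1) and (-1)^i for an index i counted
   from 1 become (-1)^i and (-1)^(i+1) here, while (-1)^(i+j) is unchanged.
   In [delta_g], [delta_V] and [Omega_T] the cochain (f_g, f_V) has degree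
   n = m + 1; in [partial_T] theta takes k = m arguments.
   [omit i (upd x j y)] is (.., x_i omitted, .., y in place of x_j, ..). *)
Section Operators.
Variables (k : fieldType) (g : lieAlgType k) (V : lmodType k).
Variables (rho : lie_rep g V) (T : {linear V -> g}).

Definition delta_g m (f : ('I_m.+1 -> g) -> g) (x : 'I_m.+2 -> g) : g :=
  \sum_(i < m.+2) (-1) ^+ i *: lieb (x i) (f (omit i x)) +
  \sum_(i < m.+2) \sum_(j < m.+2 | (i < j)%N)
    (-1) ^+ (i + j) *: f (fcons (lieb (x i) (x j)) (omit2 i j x)).

Definition delta_V m (fg : ('I_m.+1 -> g) -> g) (fV : ('I_m -> g) -> V -> V)
    (x : 'I_m.+1 -> g) (v : V) : V :=
  \sum_(i < m.+1) \sum_(j < m.+1 | (i < j)%N)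
    (-1) ^+ i.+1 *: fV (omit i (upd x j (lieb (x i) (x j)))) v +
  (-1) ^+ m *: rho (fg x) v +
  \sum_(i < m.+1) (-1) ^+ i *: (rho (x i) (fV (omit i x) v) - fV (omit i x) (rho (x i) v)).

Definition partial_T m (theta : ('I_m -> V) -> g) (u : 'I_m.+1 -> V) : g :=
  \sum_(i < m.+1 | (i < m)%N) (-1) ^+ i *: lieb (T (u i)) (theta (omit i u)) +
  (-1) ^+ m.+1 *: lieb (theta (omit ord_max u)) (T (u ord_max)) +
  (-1) ^+ m *: T (rho (theta (omit ord_max u)) (u ord_max)) +
  \sum_(i < m.+1) \sum_(j < m.+1 | (i < j)%N)
    (-1) ^+ i.+1 *: theta (omit i (upd u j (rho (T (u i)) (u j)))).

Definition Omega_T m (fg : ('I_m.+1 -> g) -> g) (fV : ('I_m -> g) -> V -> V)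
    (v : 'I_m.+1 -> V) : g :=
  (-1) ^+ m.+1 *: (fg (fun i => T (v i)) -
                   T (fV (omit ord_max (fun i => T (v i))) (v ord_max))).

Lemma liebC x y : lieb x y = - lieb y x :> g.
Proof.
have := liebxx (x + y); rewrite (linDe _ _ (lieb_linearr _)).
rewrite (linDe _ _ (lieb_linearl x)) (linDe _ _ (lieb_linearl y)) !liebxx add0r addr0.
by move=> /eqP; rewrite addrC addr_eq0 => /eqP.
Qed.

Lemma sum_adj n (W : zmodType) (F : 'I_n -> W) (a b : 'I_n) : a != b ->
  (forall i, i != a -> i != b -> F i = 0) -> F a + F b = 0 -> \sum_i F i = 0.
Proof.
move=> ab h0 hab; rewrite (bigD1 a) //= (bigD1 b) /=; last by rewrite eq_sym.
by rewrite addrA hab add0r big1 // => i /andP[]; exact: h0.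
Qed.

Lemma dsum_adj n (W : zmodType) (F : 'I_n -> 'I_n -> W) (a b : 'I_n) :
  b = a.+1 :> nat -> F a b = 0 ->
  (forall j : 'I_n, (b < j)%N -> F a j + F b j = 0) ->
  (forall i : 'I_n, (i < a)%N -> F i a + F i b = 0) ->
  (forall i j : 'I_n, (i < j)%N -> i != a -> i != b -> j != a -> j != b -> F i j = 0) ->
  \sum_(i < n) \sum_(j < n | (i < j)%N) F i j = 0.
Proof.
move=> ab h1 h2 h3 h4; have nab : a != b by rewrite -val_eqE /= ab; lia.
apply: (@sum_adj _ _ _ a b) => // [i ia ib|].
  rewrite big_mkcond /=; apply: (@sum_adj _ _ _ a b) => // [j ja jb|].
    by case: ifP => // ij; exact: h4.
  case: (ltnP i a) => hia; last first.
    have -> : (i < b)%N = false; last by rewrite addr0.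
    by move: ia ib; rewrite -!val_eqE /= ab; lia.
  by rewrite (_ : (i < b)%N) ?h3 // ab; lia.
rewrite [X in X + _]big_mkcond [X in _ + X]big_mkcond -big_split /=; apply: big1 => j _.
case: (ltngtP b j) => hj.
- by rewrite (_ : (a < j)%N) ?h2 //; lia.
- by rewrite (_ : (a < j)%N = false) ?addr0 //; lia.
- by move/val_inj: hj => <-; rewrite (_ : (a < b)%N) ?addr0 // ab.
Qed.

Lemma ml_sum n (X Y : lmodType k) (I : finType) (P : pred I)
    (f : I -> ('I_n -> X) -> Y) :
  (forall i, P i -> multilinear (f i)) -> multilinear (fun x => \sum_(i | P i) f i x).
Proof. by move=> hf x a; apply: lin_sum => i Pi; exact: hf. Qed.

Lemma mlD n (X Y : lmodType k) (f h : ('I_n -> X) -> Y) :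
  multilinear f -> multilinear h -> multilinear (fun x => f x + h x).
Proof. by move=> hf hh x a; exact: linD. Qed.

Lemma mlZ n (X Y : lmodType k) c (f : ('I_n -> X) -> Y) :
  multilinear f -> multilinear (fun x => c *: f x).
Proof. by move=> hf x a; exact: linZ. Qed.

Lemma mlC n (X Y W : lmodType k) (h : Y -> W) (f : ('I_n -> X) -> Y) :
  linear h -> multilinear f -> multilinear (fun x => h (f x)).
Proof. by move=> hh hf x a; exact: linC (hf x a). Qed.

Lemma ml_mul n (X Y W W' : lmodType k) (B : W' -> Y -> W) (A : X -> W')
    (f : ('I_n -> X) -> Y) i :
  (forall w, linear (B w)) -> (forall y, linear (B^~ y)) -> linear A ->
  multilinear f -> multilinear (fun x => B (A (x i)) (f (omit i x))).
Proof.
move=> Bl Br hA hf x b; case: (eqVneq b i) => [->|bi].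
  move=> c u v; rewrite !upd_eq !omit_upd_eq.
  exact: (linC (Br _) hA).
move=> c u v; rewrite !upd_neq 1?eq_sym //.
exact: (linC (Bl _) (ml_omit x hf bi)).
Qed.

Lemma ml_insertion n (X Y : lmodType k) (f : ('I_n -> X) -> Y) (B : X -> X -> X)
    (i j : 'I_n.+1) :
  (forall w, linear (B w)) -> (forall w, linear (B^~ w)) ->
  multilinear f -> (i < j)%N ->
  multilinear (fun x => f (omit i (upd x j (B (x i) (x j))))).
Proof. by move=> Bl Br hf ij x b; exact: (@ml_insert k X Y n f B x i j b Bl Br hf ij). Qed.

Lemma delta_g_ml m (f : ('I_m.+1 -> g) -> g) : multilinear f -> multilinear (delta_g f).
Proof.
move=> hf; apply: mlD; apply: ml_sum => i _.
  apply: mlZ; exact: (@ml_mul _ g g g g (@lieb k g) id f i (@lieb_linearr k g) (@lieb_linearl k g)).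
apply: ml_sum => j ij; apply: mlZ => x b.
have ji : j != i by rewrite -val_eqE /= neq_ltn ij orbT.
have ij' : i != j by rewrite eq_sym.
case: (boolP ((b == i) || (b == j))) => hb.
  move=> c u v; rewrite !omit2_upd_eq //; move: c u v.
  apply: (linC (ml_fcons_head _ hf)); case/orP: hb => /eqP->.
  - by move=> c u v; rewrite !upd_eq !(upd_neq _ _ ji); exact: lieb_linearl.
  - by move=> c u v; rewrite !upd_eq !(upd_neq _ _ ij'); exact: lieb_linearr.
move: hb; rewrite negb_or => /andP[bi bj].
have [a ea] := omit2_upd x ij bi bj => c u v.
rewrite !ea !(upd_neq x _ (j := i)) 1?eq_sym // !(upd_neq x _ (j := j)) 1?eq_sym //.
exact: ml_fcons.
Qed.

Lemma delta_g_alt m (f : ('I_m.+1 -> g) -> g) :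
  multilinear f -> alternating f -> alternating (delta_g f).
Proof.
move=> hf af; apply: alt_adjacent; first exact: delta_g_ml.
move=> x a b ab xab; have nab : a != b by rewrite -val_eqE /= ab; lia.
rewrite /delta_g (@sum_adj _ _ _ a b) // ?add0r.
- apply: (dsum_adj ab) => [|j bj|i ia|i j ij ia ib ja jb].
  + by rewrite xab liebxx (@ml0 _ _ _ _ _ _ ord0 hf) ?scaler0 // /fcons unlift_none.
  + rewrite (omit2_adjl ab bj xab) xab ab addSn exprS mulN1r scaleNr.
    by rewrite subrr.
  + by rewrite (omit2_adjr ab ia xab) xab ab addnS exprS mulN1r scaleNr subrr.
  + by rewrite (alt_fcons2 _ af ij nab) ?scaler0.
- by move=> i ia ib; rewrite (alt_omit af nab) // (lin_zero (lieb_linearr _)) scaler0.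
- by rewrite (omit_adj ab xab) xab ab exprS mulN1r scaleNr subrr.
Qed.

Lemma delta_V_alt_lin m (fg : ('I_m.+1 -> g) -> g) (fV : ('I_m -> g) -> V -> V) :
  multilinear fg -> alternating fg -> alt_lin fV -> alt_lin (delta_V fg fV).
Proof.
move=> hfg afg [hfV afV lfV].
have ml v : multilinear ((delta_V fg fV)^~ v).
  apply: mlD; first apply: mlD.
  - apply: ml_sum => i _; apply: ml_sum => j ij; apply: mlZ.
    exact: (@ml_insertion _ g V (fV^~ v) (@lieb k g) i j (@lieb_linearr k g) (@lieb_linearl k g) (hfV v) ij).
  - apply: mlZ; exact: (@mlC _ g g V (rho^~ v) fg (rep_linearl rho v) hfg).
  - apply: ml_sum => i _; apply: mlZ; apply: mlD.
      exact: (@ml_mul _ g V V g rho id (fV^~ v) i (rep_linearr rho) (rep_linearl rho)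
        (@lin_id k g) (hfV v)).
    move=> x b; apply: linN; case: (eqVneq b i) => [->|bi].
      move=> c u w; rewrite !upd_eq !omit_upd_eq.
      exact: (linC (lfV _) (rep_linearl rho v)).
    move=> c u w; rewrite !upd_neq 1?eq_sym //.
    exact: (ml_omit x (hfV _) bi).
split=> // [v|x].
- apply: alt_adjacent => // x a b ab xab.
  have nab : a != b by rewrite -val_eqE /= ab; lia.
  rewrite /delta_V (afg x a b nab xab) (lin_zero (rep_linearl rho v)) scaler0 addr0.
  rewrite [X in _ + X](@sum_adj _ _ _ a b) // ?addr0.
  + apply: (dsum_adj ab) => [|j bj|i ia|i j ij ia ib ja jb].
    * rewrite xab liebxx (ml_omit0 (b := b) (hfV v)) ?scaler0 ?upd_eq //.
      by rewrite eq_sym.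
    * have ja : a != j by rewrite -val_eqE /=; lia.
      have jb : b != j by rewrite -val_eqE /=; lia.
      rewrite xab (omit_adj (b := b) ab); last by rewrite !upd_neq.
      by rewrite ab [in X in _ + X]exprS mulN1r scaleNr subrr.
    * have ia' : i != a by rewrite -val_eqE /=; lia.
      have ib' : i != b by rewrite -val_eqE /=; lia.
      have nba : b != a by rewrite eq_sym.
      set w := lieb (x i) (x a); rewrite -scalerDr -xab -/w.
      have -> : upd x a w = upd (upd x a w) b (x a).
        by rewrite -[LHS](upd_id _ b) upd_neq // -xab.
      have -> : upd x b w = upd (upd x a (x a)) b w by rewrite upd_id.
      by rewrite (alt_omit_anti _ _ _ (hfV v) (afV v)) ?scaler0.
    * by rewrite (alt_omit (afV v) nab) ?scaler0 // !upd_neq // eq_sym.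
  + move=> i ia ib; rewrite !(alt_omit (afV _) nab) //.
    by rewrite (lin_zero (rep_linearr rho _)) subr0 scaler0.
  + by rewrite (omit_adj ab xab) xab ab exprS mulN1r scaleNr subrr.
- apply: linD; first apply: linD.
  + by apply: lin_sum => i _; apply: lin_sum => j ij; exact: linZ.
  + by apply: linZ; exact: rep_linearr.
  + apply: lin_sum => i _; apply: linZ; apply: linB.
      exact: (linC (rep_linearr rho _)).
    exact: (linC (lfV _) (rep_linearr rho _)).
Qed.

Lemma partial_T_ml m (theta : ('I_m -> V) -> g) :
  multilinear theta -> multilinear (partial_T theta).
Proof.
move=> hth.
have lT : linear T by exact: linearP.
apply: mlD; first apply: mlD; first apply: mlD.
- apply: ml_sum => i _; apply: mlZ.
  exact: (@ml_mul _ V g g g (@lieb k g) T theta i (@lieb_linearr k g) (@lieb_linearl k g)).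
- apply: mlZ; apply: (@ml_mul _ V g g g (fun x y => lieb y x) T theta ord_max) => //.
  + exact: lieb_linearl.
  + exact: lieb_linearr.
- apply: mlZ; apply: mlC => //.
  apply: (@ml_mul _ V g V V (fun v x => rho x v) id theta ord_max) => //.
  + exact: rep_linearl.
  + exact: rep_linearr.
- apply: ml_sum => i _; apply: ml_sum => j ij; apply: mlZ.
  apply: (@ml_insertion _ V g theta (fun u v => rho (T u) v) i j _ _ hth ij) => w.
  + exact: rep_linearr.
  + exact: (linC (rep_linearl rho w)).
Qed.

Lemma Omega_T_ml m (fg : ('I_m.+1 -> g) -> g) (fV : ('I_m -> g) -> V -> V) :
  multilinear fg -> alt_lin fV -> multilinear (Omega_T fg fV).
Proof.
move=> hfg [hfV _ lfV]; have lT : linear T by exact: linearP.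
have E n (x : 'I_n -> V) b u : (fun i => T (upd x b u i)) = upd (fun i => T (x i)) b (T u).
  by apply/funext => i; rewrite /upd; case: eqP.
apply: mlZ; apply: mlD => [x b c u v|x b].
  by rewrite !E; exact: (linC (hfg _ b)).
apply: linN; apply: (linC lT); case: (eqVneq b ord_max) => [->|bm] c u v.
  by rewrite !E !omit_upd_eq !upd_eq; exact: lfV.
rewrite !E !upd_neq 1?eq_sym //.
exact: (linC (ml_omit _ (hfV _) bm) lT).
Qed.

End Operators.

Section Complexes.
Variables (k : fieldType) (g : lieAlgType k) (V : lmodType k).
Variables (rho : lie_rep g V) (T : {linear V -> g}).

Definition grhoC m : lmodType k := (altHom g g m.+1 * altTensorHom g V V m)%type.
Definition TC m : lmodType k := tensorHom V g m.

Fact delta_g_linear m x : linear (fun f : ('I_m.+1 -> g) -> g => delta_g f x).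
Proof.
rewrite /delta_g; apply: linD.
  by apply: lin_sum => i _; apply: linZ => c p q; rewrite -lieb_linearr.
by apply: lin_sum => i _; apply: lin_sum => j _; apply: linZ.
Qed.

Fact delta_V_linear m x v :
  linear (fun f : (('I_m.+1 -> g) -> g) * (('I_m -> g) -> V -> V) =>
    delta_V rho f.1 f.2 x v).
Proof.
rewrite /delta_V; apply: linD; first apply: linD.
- by apply: lin_sum => i _; apply: lin_sum => j _; apply: linZ.
- by apply: linZ => c p q; rewrite -rep_linearl.
- apply: lin_sum => i _; apply: linZ; apply: linB => // c p q.
  by rewrite -rep_linearr.
Qed.

Fact partial_T_linear m u :
  linear (fun theta : ('I_m -> V) -> g => partial_T rho T theta u).
Proof.
rewrite /partial_T; apply: linD; first apply: linD; first apply: linD.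
- by apply: lin_sum => i _; apply: linZ => c p q; rewrite -lieb_linearr.
- by apply: linZ => c p q; rewrite -lieb_linearl.
- by apply: linZ => c p q; rewrite -linearP -rep_linearl.
- by apply: lin_sum => i _; apply: lin_sum => j _; apply: linZ.
Qed.

Fact Omega_T_linear m v :
  linear (fun f : (('I_m.+1 -> g) -> g) * (('I_m -> g) -> V -> V) =>
    Omega_T T f.1 f.2 v).
Proof.
rewrite /Omega_T; apply: linZ; apply: linB => // c p q.
by rewrite -linearP.
Qed.

Definition delta_fun m (f : grhoC m) : grhoC m.+1 :=
  (mkAltHom (conj (delta_g_ml (altHomP f.1).1)
                  (delta_g_alt (altHomP f.1).1 (altHomP f.1).2)),
   mkAltTensorHom (delta_V_alt_lin rho (altHomP f.1).1 (altHomP f.1).2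
                                       (altTensorHomP f.2))).

Definition partial_fun m (theta : TC m) : TC m.+1 :=
  mkTensorHom (partial_T_ml rho T (tensorHomP theta)).

Definition Omega_fun m (f : grhoC m) : TC m.+1 :=
  mkTensorHom (Omega_T_ml T (altHomP f.1).1 (altTensorHomP f.2)).

Fact delta_is_linear m : linear (@delta_fun m).
Proof.
move=> a [f1 f2] [h1 h2]; congr pair; apply: subm_inj; rewrite [RHS]linearP /=.
  by apply/funext => x; exact: (delta_g_linear x a (subm_val f1) (subm_val h1)).
apply/funext => x; apply/funext => v.
exact: (delta_V_linear x v a (subm_val f1, subm_val f2) (subm_val h1, subm_val h2)).
Qed.
HB.instance Definition _ m :=
  GRing.isLinear.Build k _ _ _ (@delta_fun m) (@delta_is_linear m).

Fact partial_is_linear m : linear (@partial_fun m).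
Proof.
move=> a f h; apply: subm_inj; rewrite [RHS]linearP /=.
by apply/funext => u; exact: (partial_T_linear u a (subm_val f) (subm_val h)).
Qed.
HB.instance Definition _ m :=
  GRing.isLinear.Build k _ _ _ (@partial_fun m) (@partial_is_linear m).

Fact Omega_is_linear m : linear (@Omega_fun m).
Proof.
move=> a [f1 f2] [h1 h2]; apply: subm_inj; rewrite [RHS]linearP /=.
apply/funext => v.
exact: (Omega_T_linear v a (subm_val f1, subm_val f2) (subm_val h1, subm_val h2)).
Qed.
HB.instance Definition _ m :=
  GRing.isLinear.Build k _ _ _ (@Omega_fun m) (@Omega_is_linear m).

(* All cochain spaces vanish in degree 0; degree m.+1 is C^(m+1). *)
Definition zeroC : lmodType k := 'rV[k]_0.

Definition grho_obj n : lmodType k := if n is m.+1 then grhoC m else zeroC.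
Definition T_obj n : lmodType k := if n is m.+1 then TC m else zeroC.

Definition grho_diff n : {linear grho_obj n -> grho_obj n.+1} :=
  match n return {linear grho_obj n -> grho_obj n.+1} with
  | 0 => \0
  | m.+1 => @delta_fun m
  end.

Definition T_diff n : {linear T_obj n -> T_obj n.+1} :=
  match n return {linear T_obj n -> T_obj n.+1} with
  | 0 => \0
  | m.+1 => @partial_fun m
  end.

Definition Omega n : {linear grho_obj n -> T_obj n.+1} :=
  match n return {linear grho_obj n -> T_obj n.+1} with
  | 0 => \0
  | m.+1 => @Omega_fun m
  end.

Definition D_fun n (x : (grho_obj n * T_obj n)%type) :
    (grho_obj n.+1 * T_obj n.+1)%type :=
  (grho_diff n x.1, T_diff n x.2 + Omega n x.1).

Fact D_is_linear n : linear (@D_fun n).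
Proof.
move=> a x y; congr pair; first by rewrite linearP.
by rewrite !linearP [in RHS]/D_fun /= scalerDr addrACA.
Qed.
HB.instance Definition _ n := GRing.isLinear.Build k _ _ _ (@D_fun n) (@D_is_linear n).

Definition T_complex : cochain_seq k := CochainSeq T_diff.
Definition grho_complex : cochain_seq k := CochainSeq grho_diff.
Definition reg_complex : cochain_seq k :=
  @CochainSeq k (fun n => (grho_obj n * T_obj n)%type) (fun n => @D_fun n).

Definition incl_fun n (theta : T_complex n) : reg_complex n := (0, theta).
Definition proj_fun n (x : reg_complex n) : grho_complex n := x.1.

Fact incl_is_linear n : linear (@incl_fun n).
Proof. by move=> a x y; congr pair; rewrite /= scaler0 addr0. Qed.
HB.instance Definition _ n :=
  GRing.isLinear.Build k _ _ _ (@incl_fun n) (@incl_is_linear n).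

Fact proj_is_linear n : linear (@proj_fun n).
Proof. by []. Qed.
HB.instance Definition _ n :=
  GRing.isLinear.Build k _ _ _ (@proj_fun n) (@proj_is_linear n).

Fact incl_chain n (x : T_complex n) :
  incl_fun (cdiff T_complex n x) = cdiff reg_complex n (incl_fun x).
Proof. by congr pair; rewrite /= linear0 ?addr0. Qed.

Fact proj_chain n (x : reg_complex n) :
  proj_fun (cdiff reg_complex n x) = cdiff grho_complex n (proj_fun x).
Proof. by []. Qed.

Definition reg_incl : cochain_map T_complex reg_complex :=
  @CochainMap k T_complex reg_complex (fun n => @incl_fun n) incl_chain.
Definition reg_proj : cochain_map reg_complex grho_complex :=
  @CochainMap k reg_complex grho_complex (fun n => @proj_fun n) proj_chain.

End Complexes.

(* Main.v *)
(* All three differentials are instances of the coboundary [leib_d] of a left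
   Leibniz algebra with values in a representation.  For partial_T the algebra
   is V with [u, v] = rho (T u) v acting on g; a pair (f_g, f_V) is a cochain of
   the hemisemidirect product g x V, [(x, u), (y, v)] = ([x, y], rho x v), with
   adjoint coefficients, and delta is its coboundary.  Under this dictionary
   Omega_T is, up to the sign (-1)^n, composition with the morphism
   v |-> (T v, v) of Leibniz algebras and with the map of representations
   (x, v) |-> x - T v, so it anticommutes with the differentials by naturality.
   That [leib_d] squares to zero follows from Cartan calculus by induction on
   the degree: contraction with y turns it into the Lie derivative minus
   [leib_d] of the contraction. *)
Require Import Defs.
From HB Require Import structures.
From mathcomp Require Import all_boot all_order all_algebra.
From mathcomp Require Import all_classical.
From mathcomp Require Import zify.

Set Implicit Arguments.
Unset Strict Implicit.
Unset Printing Implicit Defensive.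

Import GRing.Theory.
Local Open Scope ring_scope.

(** * Connecting maps and long exact sequences *)

Section CohomologyClasses.
Variable k : fieldType.

Lemma cocycleP (C : cochain_seq k) n (z : cocycle C n) : cdiff C n (subm_val z) = 0.
Proof. by have := submP z; rewrite unfold_in => /eqP. Qed.

Lemma mk_cocycle (C : cochain_seq k) n (x : C n) : cdiff C n x = 0 ->
  exists z : cocycle C n, subm_val z = x.
Proof.
move=> hx.
have hx' : x \in submod_pred (Submodule (@cocycle_closed k C n)).
  by rewrite unfold_in; apply/eqP.
by exists (Subm hx').
Qed.

Lemma coh_class_ind (C : cochain_seq k) n (P : cohomology C n -> Prop) :
  (forall z, P (coh_class C n z)) -> forall q, P q.
Proof. exact: lquot_ind. Qed.

Lemma coh_class_eq (C : cochain_seq k) n (z w : cocycle C n) :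
  coh_class C n z = coh_class C n w <-> coboundary (subm_val z - subm_val w).
Proof.
rewrite -raddfB; split=> [/lquot_piP|h]; first by rewrite unfold_in => /asboolP.
by apply/lquot_piP; rewrite unfold_in; apply/asboolP.
Qed.

Lemma coh_class_eq0 (C : cochain_seq k) n (z : cocycle C n) :
  coh_class C n z = 0 <-> coboundary (subm_val z).
Proof.
have z0 : subm_val z - subm_val (0 : cocycle C n) = subm_val z by exact: subr0.
by have := coh_class_eq z 0; rewrite linear0 z0.
Qed.

Lemma cohomology_map_eq (A B : cochain_seq k) (phi : cochain_map A B) n
    (z : cocycle A n) (w : cocycle B n) :
  cohomology_map phi n (coh_class A n z) = coh_class B n w <->
  coboundary (phi n (subm_val z) - subm_val w).
Proof.
rewrite -(coh_class_eq (cocycle_map phi n z)) -[X in _ <-> X = _]/(lquot_pi _ _).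
by rewrite -(lquot_mapE (@cocycle_map_coboundary k A B phi n)).
Qed.

Lemma cohomology_map_eq0 (A B : cochain_seq k) (phi : cochain_map A B) n
    (z : cocycle A n) :
  cohomology_map phi n (coh_class A n z) = 0 <-> coboundary (phi n (subm_val z)).
Proof.
rewrite -(coh_class_eq0 (cocycle_map phi n z)) -[X in _ <-> X = _]/(lquot_pi _ _).
by rewrite -(lquot_mapE (@cocycle_map_coboundary k A B phi n)).
Qed.

Lemma coboundary_cocycle (C : cochain_seq k) n (x : C n) :
  is_complex C -> coboundary x -> cdiff C n x = 0.
Proof. by case: n x => [x _ ->|n x dC [y <-]]; rewrite ?linear0 ?dC. Qed.

(** * Diagram chase from the short to the long exact sequence *)

Section LongExact.
Variables (A B C : cochain_seq k) (i : cochain_map A B) (p : cochain_map B C).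
Hypothesis dB : is_complex B.
Hypothesis ip : short_exact i p.

Let i_inj n : injective (i n). Proof. by case: (ip n). Qed.

Let pK n y : p n y = 0 -> exists x, i n x = y.
Proof. by case: (ip n) => _ h _ /h. Qed.

Let pi0 n x : p n (i n x) = 0.
Proof. by case: (ip n) => _ h _; apply/h; exists x. Qed.

Let lift_p n z : exists y, p n y = z. Proof. by case: (ip n). Qed.

(** As [p] commutes with the differentials, [d y] lies in the kernel of [p], hence comes from some
    [x]; injectivity of [i] and [d d = 0] in [B] make [x] a cocycle. *)
Lemma snake_pull n (y : B n) : cdiff C n (p n y) = 0 ->
  exists x : cocycle A n.+1, i n.+1 (subm_val x) = cdiff B n y.
Proof.
rewrite -cmapP => /pK[x ex].
have [|w ew] := @mk_cocycle A n.+1 x; last by exists w; rewrite ew.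
by apply: i_inj; rewrite cmapP ex dB linear0.
Qed.

Variable c : forall n, {linear cohomology C n -> cohomology A n.+1}.
Hypothesis hc : connecting i p c.

(** The property [connecting] determines [c] on every class, since [lift_p] and [snake_pull] always
    supply the data it asks for; exactness is then a chase on representatives. *)
Lemma connecting_long_exact : long_exact i p c.
Proof.
split=> [|n].
  apply: raddf_inj; elim/coh_class_ind => z /cohomology_map_eq0 /= h.
  by apply/coh_class_eq0; apply: i_inj; rewrite h linear0.
split.
- elim/coh_class_ind => y; split=> [/cohomology_map_eq0 h|[q]]; last first.
    elim/coh_class_ind: q => x /cohomology_map_eq h.
    apply/cohomology_map_eq0; have := cmap_coboundary p h.
    rewrite linearB pi0 sub0r => /(coboundaryD (-1))/(_ (coboundary0 _ _)).
    by rewrite scaleN1r opprK addr0.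
  (* If [p y] is the coboundary of [z], a lift of [z] has a differential [b] with [p b = p y]; in
     degree 0 take [b = 0]. Then [y - b] comes from [A] and represents the same class as [y]. *)
  have [b [cb pyb]] : exists b, coboundary b /\ p n (subm_val y) = p n b.
    case: n y h => /= [y ->|n y [z <-]]; first by exists 0; rewrite linear0.
    have [b <-] := lift_p z.
    by exists (cdiff B n b); split; [exists b|rewrite cmapP].
  have db := coboundary_cocycle dB cb.
  have [|x ex] := @pK n (subm_val y - b); first by rewrite linearB pyb subrr.
  have [|w ew] := @mk_cocycle A n x.
    by apply: i_inj; rewrite cmapP ex linearB cocycleP db subrr linear0.
  exists (coh_class A n w); apply/cohomology_map_eq.
  rewrite ew ex addrAC subrr sub0r.
  have := coboundaryD (-1) cb (coboundary0 _ _).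
  by rewrite scaleN1r addr0.
- elim/coh_class_ind => z; split=> [|[q]]; last first.
    elim/coh_class_ind: q => y /cohomology_map_eq h.
    rewrite -((coh_class_eq (cocycle_map p n y) z).2 h).
    (* The cocycle [y] is itself a lift of [p y], and its zero differential pulls back to 0. *)
    have e0 : i n.+1 (subm_val (0 : cocycle A n.+1)) = cdiff B n (subm_val y).
      by rewrite cocycleP; exact: linear0.
    by rewrite (hc (z := cocycle_map p n y) erefl e0) linear0.
  have [y ey] := lift_p (subm_val z).
  have [|x ex] := @snake_pull n y; first by rewrite ey cocycleP.
  rewrite (hc ey ex) => /coh_class_eq0 [a ea].
  (* With [x = d a], subtracting [i a] turns the lift [y] into a cocycle and leaves its image under
     [p] unchanged. *)
  have [|w ew] := @mk_cocycle B n (y - i n a).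
    by rewrite linearB -cmapP ea ex subrr.
  exists (coh_class B n w); apply/cohomology_map_eq.
  by rewrite ew linearB pi0 subr0 ey subrr; exact: coboundary0.
- elim/coh_class_ind => x; split=> [|[q]]; last first.
    elim/coh_class_ind: q => z.
    have [y ey] := lift_p (subm_val z).
    have [|x' ex'] := @snake_pull n y; first by rewrite ey cocycleP.
    rewrite (hc ey ex') => <-; apply/cohomology_map_eq0.
    by exists y; rewrite -ex'.
  move=> /cohomology_map_eq0 [y ey].
  (* Since [i x = d y], the cochain [p y] is a cocycle, and [y] is a lift showing that its
     connecting image is the class of [x]. *)
  have [|z ez] := @mk_cocycle C n (p n y); first by rewrite -cmapP ey pi0.
  by exists (coh_class C n z); apply: (hc (y := y)).
Qed.

End LongExact.

End CohomologyClasses.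

(** * Cohomology of left Leibniz algebras *)

Section ConsFamilies.
Variable X : Type.

Lemma fcons_eta n (x : 'I_n.+1 -> X) : fcons (x ord0) (omit ord0 x) = x.
Proof. by apply/funext => l; rewrite /fcons; case: unliftP => [l' ->|->]. Qed.

Lemma fcons0 n u (x : 'I_n -> X) : fcons u x ord0 = u.
Proof. by rewrite /fcons unlift_none. Qed.

Lemma fcons_lift n u (x : 'I_n -> X) l : fcons u x (lift ord0 l) = x l.
Proof. by rewrite /fcons liftK. Qed.

Lemma omit0_fcons n u (x : 'I_n -> X) : omit ord0 (fcons u x) = x.
Proof. by apply/funext => l; rewrite /omit fcons_lift. Qed.

Lemma omit_fcons n u (x : 'I_n.+1 -> X) l :
  omit (lift ord0 l) (fcons u x) = fcons u (omit l x).
Proof.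
apply/funext => a; rewrite /omit; case: (unliftP ord0 a) => [b ->|->].
  have -> : lift (lift ord0 l) (lift ord0 b) = lift ord0 (lift l b).
    by apply: val_inj; rewrite /= /bump; lia.
  by rewrite !fcons_lift.
by rewrite (_ : lift _ _ = ord0) ?fcons0 //; apply: val_inj.
Qed.

(** After the removal of [i], the index [j] sits at position [p]. This links the double omission in
    [delta_g] to the insertion form in [leib_d]. *)
Lemma omit2E n (x : 'I_n.+2 -> X) (i j : 'I_n.+2) (p : 'I_n.+1) :
  (i < j)%N -> j = lift i p -> omit2 i j x = omit p (omit i x).
Proof.
move=> ij jp; apply/funext => l; rewrite /omit2 /omit; congr x.
apply: val_inj; rewrite /= inordK ?omit2_val //.
by move: ij; rewrite jp /= /bump; lia.
Qed.

End ConsFamilies.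

(** Moving entry [p] to the front takes [p] adjacent swaps. The induction freezes the first entry,
    brings [z p] to the second place, and swaps these two by [alt_anti]. *)
Lemma alternating_front (k : fieldType) (X Y : lmodType k) n
    (f : ('I_n.+1 -> X) -> Y) (z : 'I_n.+1 -> X) (p : 'I_n.+1) :
  multilinear f -> alternating f ->
  f z = (-1) ^+ p *: f (fcons (z p) (omit p z)).
Proof.
elim: n f z p => [|n IH] f z p hf af.
  by rewrite (ord1 p) expr0 scale1r fcons_eta.
case: (unliftP ord0 p) => [q ->|->]; last by rewrite expr0 scale1r fcons_eta.
rewrite -{1 2 3}(fcons_eta z); set a := z ord0; set z' := omit ord0 z.
rewrite fcons_lift omit_fcons.
have hfa : multilinear (fun s => f (fcons a s)) by move=> s b; exact: ml_fcons.
have afa : alternating (fun s => f (fcons a s)).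
  move=> s b c bc sbc; apply: (af _ (lift ord0 b) (lift ord0 c)).
    by rewrite (inj_eq lift_inj).
  by rewrite !fcons_lift.
rewrite (IH _ z' q hfa afa) /= /bump leq0n exprS mulN1r scaleNr -scalerN.
congr (_ *: _).
set y := omit q z'; set b := z' q.
have h01 : ord0 != lift ord0 ord0 :> 'I_n.+2 by [].
have := alt_anti (fcons a (fcons b y)) a b hf af h01.
have E u w : upd (upd (fcons a (fcons b y)) ord0 u) (lift ord0 ord0) w =
             fcons u (fcons w y).
  by rewrite -fcons_head -fcons_upd -fcons_head.
by rewrite !E => /eqP; rewrite addr_eq0 => /eqP.
Qed.

Lemma lin_opp (k : fieldType) (X Y : lmodType k) (f : X -> Y) u :
  linear f -> f (- u) = - f u.
Proof. by move=> hf; have := hf (-1) u 0; rewrite (lin_zero hf) !scaleN1r !addr0. Qed.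

Lemma lin_sub (k : fieldType) (X Y : lmodType k) (f : X -> Y) u v :
  linear f -> f (u - v) = f u - f v.
Proof. by move=> hf; rewrite (linDe _ _ hf) lin_opp. Qed.

(** * The Leibniz coboundary and its Cartan calculus *)

Section LeibnizCohomology.
Variables (k : fieldType) (L M : lmodType k).
Variables (br : L -> L -> L) (l : L -> M -> M) (r : M -> L -> M).

Definition leib_d m (f : ('I_m -> L) -> M) (u : 'I_m.+1 -> L) : M :=
  \sum_(i < m.+1 | (i < m)%N) (-1) ^+ i *: l (u i) (f (omit i u)) +
  (-1) ^+ m.+1 *: r (f (omit ord_max u)) (u ord_max) +
  \sum_(i < m.+1) \sum_(j < m.+1 | (i < j)%N)
    (-1) ^+ i.+1 *: f (omit i (upd u j (br (u i) (u j)))).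

Definition lie_der m (y : L) (f : ('I_m -> L) -> M) (u : 'I_m -> L) : M :=
  l y (f u) - \sum_(j < m) f (upd u j (br y (u j))).

Definition contract m (y : L) (f : ('I_m.+1 -> L) -> M) : ('I_m -> L) -> M :=
  fun u => f (fcons y u).

(** This reduces an identity in degree [m + 1] to its contractions in degree [m], which drives the
    inductions below. *)
Lemma contract_inj m (f h : ('I_m.+1 -> L) -> M) :
  (forall y, contract y f = contract y h) -> f = h.
Proof.
move=> fh; apply/funext => u; rewrite -(fcons_eta u).
exact: (congr1 (@^~ (omit ord0 u)) (fh (u ord0))).
Qed.

Lemma contractB m y (f h : ('I_m.+1 -> L) -> M) :
  contract y (f - h) = contract y f - contract y h.
Proof. by []. Qed.

(** The Cartan relation for [L_x] and [i_y]: the term of [L_x f] that acts on the first argument [y]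
    is the contraction with [[x, y]]. *)
Lemma lie_der_contract m x y (f : ('I_m.+1 -> L) -> M) :
  contract y (lie_der x f) = lie_der x (contract y f) - contract (br x y) f.
Proof.
apply/funext => u; rewrite /contract /lie_der big_ord_recl.
rewrite fcons0 -fcons_head [RHS]/GRing.add /= opprD addrA addrAC.
congr (_ - _ - _); apply: eq_bigr => j _.
by rewrite fcons_upd fcons_lift.
Qed.

(* Cartan's formula: i_y d + d i_y = L_y. *)
Lemma leib_d_contract m y (f : ('I_m.+1 -> L) -> M) :
  contract y (leib_d f) = lie_der y f - leib_d (contract y f).
Proof.
apply/funext => u; rewrite /contract [RHS]/GRing.add /= /lie_der /leib_d.
(* Index 0 gives the action of [y]; the remaining indices drop by one, which flips every sign. *)
have -> : \sum_(i < m.+2 | (i < m.+1)%N)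
     (-1) ^+ i *: l (fcons y u i) (f (omit i (fcons y u))) =
   l y (f u) - \sum_(i < m.+1 | (i < m)%N)
     (-1) ^+ i *: l (u i) (f (fcons y (omit i u))).
  rewrite big_mkcond big_ord_recl /= fcons0 omit0_fcons expr0 scale1r.
  congr (_ + _); rewrite -big_mkcond /= -sumrN; apply: eq_big => [i|i _].
    by rewrite /bump add1n ltnS.
  by rewrite fcons_lift omit_fcons /bump add1n exprS mulN1r scaleNr.
have -> : ord_max = lift ord0 (ord_max : 'I_m.+1) by apply: val_inj.
rewrite omit_fcons fcons_lift.
(* The row [i = 0] deletes [y] and inserts [[y, u_j]], which is the sum in the Lie derivative. *)
have -> : \sum_(i < m.+2) \sum_(j < m.+2 | (i < j)%N) (-1) ^+ i.+1 *:
     f (omit i (upd (fcons y u) j (br (fcons y u i) (fcons y u j)))) =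
   - (\sum_(j < m.+1) f (upd u j (br y (u j)))) -
   \sum_(i < m.+1) \sum_(j < m.+1 | (i < j)%N) (-1) ^+ i.+1 *:
     f (fcons y (omit i (upd u j (br (u i) (u j))))).
  rewrite big_ord_recl; congr (_ + _).
    rewrite big_mkcond big_ord_recl /= add0r -sumrN; apply: eq_bigr => j _.
    by rewrite expr1 scaleN1r fcons0 fcons_lift -fcons_upd omit0_fcons.
  rewrite -sumrN; apply: eq_bigr => i _; rewrite big_mkcond big_ord_recl /= add0r.
  rewrite -sumrN [RHS]big_mkcond; apply: eq_bigr => j _.
  rewrite /bump !add1n ltnS; case: ifP => // _.
  by rewrite !fcons_lift -fcons_upd omit_fcons exprS mulN1r scaleNr.
rewrite exprS mulN1r scaleNr [in RHS]/GRing.opp /= !opprD !addrA.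
congr (_ - _); rewrite [LHS]addrAC; congr (_ - _).
by rewrite addrAC.
Qed.

(** The base case of the inductions, where Cartan's formula has no argument to contract: only the
    right action survives. *)
Lemma leib_d_deg0 (f : ('I_0 -> L) -> M) u :
  leib_d f u = - r (f (omit ord0 u)) (u ord0).
Proof.
rewrite /leib_d big_pred0 // add0r expr1 scaleN1r (ord1 ord_max).
by rewrite !big_ord1 /= big_pred0 ?addr0 // => i; rewrite (ord1 i).
Qed.

Hypotheses (l_lin : forall x, linear (l x)) (r_lin : forall x, linear (r^~ x)).

Lemma lie_derB m y (f h : ('I_m -> L) -> M) :
  lie_der y (f - h) = lie_der y f - lie_der y h.
Proof.
apply/funext => u; rewrite [RHS]/GRing.add [in RHS]/GRing.opp /= /lie_der.
rewrite (lin_sub _ _ (l_lin y)).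
by rewrite sumrB !opprB addrACA [RHS]addrACA; congr (_ + _); rewrite addrC.
Qed.

Lemma leib_dB m (f h : ('I_m -> L) -> M) :
  leib_d (f - h) = leib_d f - leib_d h.
Proof.
elim: m f h => [|m IH] f h.
  apply/funext => u; rewrite [RHS]/GRing.add [in RHS]/GRing.opp /= !leib_d_deg0.
  by rewrite (lin_sub _ _ (r_lin _)) opprB opprK addrC.
apply: contract_inj => y; rewrite !contractB !leib_d_contract lie_derB contractB IH.
by rewrite !opprB addrACA [RHS]addrACA; congr (_ + _); rewrite addrC.
Qed.

(** The left Leibniz identity, followed by the three axioms of a representation with left action [l]
    and right action [r]. *)
Hypothesis brJ : forall x y z, br x (br y z) = br (br x y) z + br y (br x z).
Hypothesis lJ : forall x y a, l (br x y) a = l x (l y a) - l y (l x a).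
Hypothesis lrJ : forall x y a, l x (r a y) = r (l x a) y + r a (br x y).
Hypothesis rJ : forall x y a, r (l x a + r a x) y = 0.

Lemma contract_ml m y (f : ('I_m.+1 -> L) -> M) :
  multilinear f -> multilinear (contract y f).
Proof. by move=> hf u a; exact: ml_fcons. Qed.

Lemma contractD m y z (f : ('I_m.+1 -> L) -> M) :
  multilinear f -> contract (y + z) f = contract y f + contract z f.
Proof. by move=> hf; apply/funext => u; exact: (linDe _ _ (ml_fcons_head u hf)). Qed.

(** After contraction with [z], the inductive hypothesis handles [i_z f], the mixed terms cancel,
    and the contractions with iterated brackets match by the Leibniz identity. *)
Lemma lie_der_br m x y (f : ('I_m -> L) -> M) : multilinear f ->
  lie_der x (lie_der y f) - lie_der y (lie_der x f) = lie_der (br x y) f.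
Proof.
elim: m f => [|m IH] f hf.
  apply/funext => u; rewrite [LHS]/GRing.add [in LHS]/GRing.opp /= /lie_der.
  by rewrite !big_ord0 !subr0 lJ.
apply: contract_inj => z; rewrite contractB !lie_der_contract.
set a := lie_der x (contract z f); set b := lie_der y (contract z f).
rewrite (lie_derB x b) (lie_derB y a) /a /b {a b}.
rewrite -IH; last exact: contract_ml.
rewrite (brJ x y z) contractD //.
set A := lie_der x (lie_der y _); set B := lie_der y (lie_der x _).
set P := lie_der x _; set Q := lie_der y _; set R := contract (br y _) f.
set S := contract _ f.
move: A B P Q R S => A B P Q R S.
rewrite !opprB !opprD !addrA.
by rewrite (ACl ((2*5)*(3*7)*(4*8)*(1*9*6))) /= !addNr subrr !add0r.
Qed.

(** Contracting with [y] and applying Cartan's formula on both sides leaves [[L_x, L_y] = L_[x,y]]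
    and the same claim for [i_y f]; degree 0 is the axiom [lrJ]. *)
Lemma leib_d_lie_der m x (f : ('I_m -> L) -> M) : multilinear f ->
  leib_d (lie_der x f) = lie_der x (leib_d f).
Proof.
elim: m f => [|m IH] f hf.
  apply/funext => u; rewrite leib_d_deg0 /lie_der !big_ord0 subr0 big_ord1.
  rewrite !leib_d_deg0 upd_eq omit_upd_eq (lin_opp _ (l_lin x)) lrJ.
  by rewrite opprK opprD addrNK.
apply: contract_inj => y.
rewrite leib_d_contract !lie_der_contract !leib_d_contract leib_dB lie_derB.
rewrite IH; last exact: contract_ml.
rewrite -(lie_der_br _ _ hf).
set A := lie_der x (lie_der y _); set B := lie_der y (lie_der x _).
set P := lie_der x _; set Q := leib_d (contract (br x y) f).
move: A B P Q => A B P Q.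
rewrite !opprB !addrA.
by rewrite [RHS](ACl ((1*5)*(4*3*2))) /= subrr add0r.
Qed.

(** Two uses of Cartan's formula give [i_x d d f = (L_x d - d L_x) f + d d i_x f]; the first part
    vanishes by [leib_d_lie_der], the second by induction. *)
Lemma leib_d_d m (f : ('I_m -> L) -> M) : multilinear f -> leib_d (leib_d f) = 0.
Proof.
elim: m f => [|m IH] f hf.
  apply: contract_inj => x; rewrite leib_d_contract.
  apply/funext => u; rewrite [LHS]/GRing.add [in LHS]/GRing.opp /=.
  rewrite leib_d_deg0 /lie_der /contract big_ord1 !leib_d_deg0 upd_eq.
  rewrite !omit_upd_eq (lin_opp _ (l_lin x)) lrJ.
  rewrite fcons0 omit0_fcons.
  have rN b w : r (- b) w = - r b w := lin_opp b (r_lin w).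
  have rD b c w : r (b + c) w = r b w + r c w := linDe b c (r_lin w).
  (* For a constant [a] the remainder is [- r (l x a + r a x) u0], which is zero by [rJ]. *)
  rewrite rN !opprK opprD addrNK -[RHS]oppr0 -(rJ x (u ord0) (f (omit ord0 u))).
  by rewrite rD opprD.
apply: contract_inj => x; rewrite leib_d_contract leib_d_contract leib_dB.
rewrite IH; last exact: contract_ml.
by rewrite subr0 leib_d_lie_der // subrr.
Qed.

End LeibnizCohomology.

(** * Lie-Leibniz triples *)

Lemma upd_comp (X Y : Type) (h : X -> Y) n (x : 'I_n -> X) i u :
  (fun j => h (upd x i u j)) = upd (fun j => h (x j)) i (h u).
Proof. by apply/funext => j; rewrite /upd; case: eqP. Qed.

Lemma omit_maxC (X : Type) n (i : 'I_n.+1) (x : 'I_n.+2 -> X) :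
  omit ord_max (omit (lift ord_max i) x) = omit i (omit ord_max x).
Proof.
apply/funext => l; rewrite /omit; congr x; apply: val_inj.
by rewrite /= /bump; have := ltn_ord i; have := ltn_ord l; lia.
Qed.

Lemma omit_lift_max (X : Type) n (i : 'I_n.+1) (x : 'I_n.+2 -> X) :
  omit (lift ord_max i) x ord_max = x ord_max.
Proof.
rewrite /omit; congr x; apply: val_inj.
by rewrite /= /bump; have := ltn_ord i; lia.
Qed.

Lemma big_ord_lift_max (W : zmodType) n (F : 'I_n.+1 -> W) :
  \sum_(i < n.+1) F i = \sum_(i < n) F (lift ord_max i) + F ord_max.
Proof.
rewrite big_ord_recr; congr (_ + _); apply: eq_bigr => i _; congr F.
by apply: val_inj; rewrite /= /bump; have := ltn_ord i; lia.
Qed.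

Lemma big_ord_lt_max (W : zmodType) n (F : 'I_n.+1 -> W) :
  \sum_(i < n.+1 | (i < n)%N) F i = \sum_(i < n) F (lift ord_max i).
Proof.
rewrite big_mkcond big_ord_lift_max ltnn addr0; apply: eq_bigr => i _.
by rewrite lift_max ltn_ord.
Qed.

Lemma lin_scale (k : fieldType) (X Y : lmodType k) (f : X -> Y) a u :
  linear f -> f (a *: u) = a *: f u.
Proof. by move=> hf; have := hf a u 0; rewrite (lin_zero hf) !addr0. Qed.

(** Each term of [leib_d] is carried across by the algebra morphism [phi] and the map [h], which
    intertwines the actions pulled back along [phi]. *)
Lemma leib_d_natural (k : fieldType) (L L' M M' : lmodType k)
    (br : L -> L -> L) (l : L -> M -> M) (r : M -> L -> M)
    (br' : L' -> L' -> L') (l' : L' -> M' -> M') (r' : M' -> L' -> M')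
    (phi : L' -> L) (h : M -> M') :
  (forall a b, phi (br' a b) = br (phi a) (phi b)) -> linear h ->
  (forall a x, h (l (phi a) x) = l' a (h x)) ->
  (forall a x, h (r x (phi a)) = r' (h x) a) ->
  forall m (f : ('I_m -> L) -> M) (u : 'I_m.+1 -> L'),
    leib_d br' l' r' (fun v => h (f (fun i => phi (v i)))) u =
    h (leib_d br l r f (fun i => phi (u i))).
Proof.
move=> hphi hh hl hr m f u; rewrite /leib_d.
have hD := linDe _ _ hh.
have hZ a x := lin_scale a x hh.
have hS (I : finType) (P : pred I) F : h (\sum_(i | P i) F i) = \sum_(i | P i) h (F i).
  by apply: big_morph => // ; exact: lin_zero.
rewrite !hD !hS; congr (_ + _ + _).
- by apply: eq_bigr => i _; rewrite hZ hl.
- by rewrite hZ hr.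
- apply: eq_bigr => i _; rewrite hS; apply: eq_bigr => j _.
  by rewrite hZ -hphi -upd_comp.
Qed.

Section Triple.
Variables (k : fieldType) (g : lieAlgType k) (V : lmodType k).
Variables (rho : lie_rep g V) (T : {linear V -> g}).

Lemma lieb_leibniz (x y z : g) :
  lieb x (lieb y z) = lieb (lieb x y) z + lieb y (lieb x z).
Proof.
have := lieb_jacobi x y z; rewrite [X in _ + X]liebC => /eqP.
rewrite subr_eq0 => /eqP <-; rewrite [lieb z x]liebC.
by rewrite (lin_opp _ (lieb_linearr _)) addrNK.
Qed.

(** Antisymmetry turns the right action on the last argument into the missing left term. In the
    double sum the bracket sits at position [p = j - 1], and bringing it to the front turns the sign
    [(-1)^(i+1)] into [(-1)^(i+j)]. *)
Lemma delta_g_leib_d m (f : ('I_m.+1 -> g) -> g) : multilinear f -> alternating f ->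
  delta_g f = leib_d (@lieb k g) (@lieb k g) (@lieb k g) f.
Proof.
move=> hf af; apply/funext => x; rewrite /delta_g /leib_d; congr (_ + _).
  rewrite big_ord_lt_max [X in X = _]big_ord_lift_max; congr (_ + _).
  by rewrite exprS mulN1r scaleNr -scalerN -liebC.
apply: eq_bigr => i _; apply: eq_bigr => j ij.
have [p jp] : {p | j = lift i p}.
  by case: (unliftP i j) ij => [p ->|->]; [exists p|rewrite ltnn].
rewrite (@alternating_front _ _ _ _ f (omit i (upd x j _)) p) //.
rewrite scalerA -exprD {1}/omit -jp upd_eq jp omit_upd omit_upd_eq -jp.
rewrite (omit2E x ij jp); congr (_ *: _).
have -> : nat_of_ord j = p.+1 by move: ij; rewrite jp /= /bump; lia.
by rewrite addnS addSn.
Qed.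

(** * Pairs [(f_g, f_V)] as cochains of the hemisemidirect product *)

Definition hemi_br (X Y : g * V) : g * V := (lieb X.1 Y.1, rho X.1 Y.2).

Definition hemi_cochain m (fg : ('I_m.+1 -> g) -> g) (fV : ('I_m -> g) -> V -> V)
    (X : 'I_m.+1 -> g * V) : g * V :=
  (fg (fun i => (X i).1), fV (omit ord_max (fun i => (X i).1)) (X ord_max).2).

Lemma hemi_cochain_ml m (fg : ('I_m.+1 -> g) -> g) (fV : ('I_m -> g) -> V -> V) :
  multilinear fg -> alt_lin fV -> multilinear (hemi_cochain fg fV).
Proof.
move=> hg [hV _ lV] X i a u v; rewrite /hemi_cochain !(upd_comp fst) /=.
congr pair; first exact: hg.
case: (unliftP ord_max i) => [j ->|->].
  rewrite !omit_upd /= !upd_neq ?neq_lift //; exact: hV.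
by rewrite !omit_upd_eq !upd_eq; exact: lV.
Qed.

Lemma hemi_cochain_eq0 m (fg : ('I_m.+1 -> g) -> g) (fV : ('I_m -> g) -> V -> V) :
  hemi_cochain fg fV = 0 -> fg = 0 /\ fV = 0.
Proof.
move=> h; split.
  apply/funext => x.
  exact: (congr1 (fun F => (F (fun i => (x i, 0))).1) h).
apply/funext => x; apply/funext => v.
(* The value 0 in the last [g]-slot is discarded by [omit ord_max], and only the last [V]-slot is
   read. *)
pose X i := (if unlift ord_max i is Some j then x j else 0, v).
have := congr1 (fun F => (F X).2) h.
rewrite /hemi_cochain /= /omit => h'; rewrite -[RHS]h'; congr fV.
by apply/funext => l; rewrite liftK.
Qed.

Lemma hemi_leib_d m (fg : ('I_m.+1 -> g) -> g) (fV : ('I_m -> g) -> V -> V) :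
  multilinear fg -> alternating fg ->
  leib_d hemi_br hemi_br hemi_br (hemi_cochain fg fV) =
  hemi_cochain (delta_g fg) (delta_V rho fg fV).
Proof.
move=> hf af; apply/funext => X; rewrite [LHS]surjective_pairing; congr pair.
  rewrite delta_g_leib_d //.
  (* Naturality is applied twice through an intermediate representation, [g] acted on via [fst]:
     once with [fst] on the algebra, once with [fst] on the coefficients. *)
  pose l' (Y : g * V) (x : g) := lieb Y.1 x; pose r' (x : g) (Y : g * V) := lieb x Y.1.
  rewrite -(@leib_d_natural _ g _ g g _ _ _ hemi_br l' r' fst id) //.
  exact: esym (@leib_d_natural _ _ _ _ _ hemi_br hemi_br hemi_br hemi_br l' r' id fst
    (fun _ _ => erefl) (fun _ _ _ => erefl) (fun _ _ => erefl)
    (fun _ _ => erefl) _ (hemi_cochain fg fV) X).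
rewrite /leib_d /delta_V.
set x := omit ord_max (fun i => (X i).1); set v := (X ord_max).2.
have sndD (A B : g * V) : (A + B).2 = A.2 + B.2 by [].
have sndS (I : finType) (P : pred I) (F : I -> g * V) :
    (\sum_(i | P i) F i).2 = \sum_(i | P i) (F i).2.
  exact: (big_morph snd sndD).
have E (i : 'I_m.+1) (Y : 'I_m.+2 -> g * V) :
    omit ord_max (fun j => (omit (lift ord_max i) Y j).1) =
    omit i (omit ord_max (fun j => (Y j).1)).
  exact: omit_maxC i (fun j => (Y j).1).
rewrite !sndD !sndS.
have -> : \sum_(i < m.+2 | (i < m.+1)%N)
    ((-1) ^+ i *: hemi_br (X i) (hemi_cochain fg fV (omit i X))).2 =
  \sum_(i < m.+1) (-1) ^+ i *: rho (x i) (fV (omit i x) v).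
  rewrite big_ord_lt_max; apply: eq_bigr => i _.
  by rewrite lift_max /= omit_lift_max E.
(* The column [j = ord_max] inserts [rho (x i) v] into the [V]-slot and yields the subtracted sum;
   the row [i = ord_max] is empty. *)
have -> : \sum_(i < m.+2) (\sum_(j < m.+2 | (i < j)%N)
    (-1) ^+ i.+1 *: hemi_cochain fg fV (omit i (upd X j (hemi_br (X i) (X j))))).2 =
  \sum_(i < m.+1) \sum_(j < m.+1 | (i < j)%N)
    (-1) ^+ i.+1 *: fV (omit i (upd x j (lieb (x i) (x j)))) v -
  \sum_(i < m.+1) (-1) ^+ i *: fV (omit i x) (rho (x i) v).
  rewrite big_ord_lift_max [X in _ + X]sndS [X in _ + X]big_pred0 ?addr0; last first.
    by move=> j; have := ltn_ord j; rewrite /= ltnS leqNgt => /negbTE.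
  rewrite -sumrB; apply: eq_bigr => i _.
  rewrite sndS big_mkcond big_ord_lift_max !lift_max ltn_ord.
  rewrite [in RHS]big_mkcond; congr (_ + _).
    apply: eq_bigr => j _; rewrite !lift_max; case: ifP => // ij.
    rewrite /= omit_lift_max upd_neq ?neq_lift // E (upd_comp fst).
    by rewrite omit_upd.
  rewrite /= omit_lift_max upd_eq E (upd_comp fst) omit_upd_eq.
  by rewrite exprS mulN1r scaleNr.
rewrite /= !exprS !mulN1r opprK.
set a := \sum_i \sum_(j | _) _.
rewrite addrA [LHS](ACl (3*2*(1*4))) /= -sumrB.
by congr (_ + _); apply: eq_bigr => i _; rewrite scalerBr.
Qed.

Lemma delta_delta m (fg : ('I_m.+1 -> g) -> g) (fV : ('I_m -> g) -> V -> V) :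
  multilinear fg -> alternating fg -> alt_lin fV ->
  delta_g (delta_g fg) = 0 /\ delta_V rho (delta_g fg) (delta_V rho fg fV) = 0.
Proof.
move=> hg ag hV; apply: hemi_cochain_eq0.
rewrite -hemi_leib_d; [|exact: delta_g_ml|exact: delta_g_alt].
rewrite -hemi_leib_d //; apply: leib_d_d (hemi_cochain_ml hg hV).
- by move=> X a Y Z; congr pair; [exact: lieb_linearr|exact: rep_linearr].
- by move=> Y a X Z; congr pair; [exact: lieb_linearl|exact: rep_linearl].
- by move=> X Y Z; congr pair; [exact: lieb_leibniz|rewrite /= rep_lieb subrK].
- move=> X Y Z; congr pair; last exact: rep_lieb.
  by rewrite /= lieb_leibniz addrK.
- by move=> X Y Z; congr pair; [exact: lieb_leibniz|rewrite /= rep_lieb subrK].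
(* The symmetrised bracket has zero [g]-part, and [hemi_br] sees its first factor only through that
   part. *)
- move=> X Y Z; rewrite /hemi_br /= [lieb X.1 _]liebC addNr.
  by rewrite (lin_zero (lieb_linearl _)) (lin_zero (rep_linearl _ _)).
Qed.

(** * The Leibniz algebra [V] acting on [g] through [T] *)

Definition T_br (u v : V) : V := rho (T u) v.
Definition T_left (u : V) (x : g) : g := lieb (T u) x.
(** The two terms of [partial_T] at the last argument have opposite signs and merge into this
    action. For a Lie-Leibniz triple it vanishes when [x] lies in the image of [T]. *)
Definition T_right (x : g) (u : V) : g := lieb x (T u) - T (rho x u).

Lemma partial_T_leib_d m (theta : ('I_m -> V) -> g) :
  partial_T rho T theta = leib_d T_br T_left T_right theta.
Proof.
apply/funext => u; rewrite /partial_T /leib_d; congr (_ + _).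
rewrite -addrA; congr (_ + _).
by rewrite scalerBr; congr (_ + _); rewrite exprS mulN1r scaleNr opprK.
Qed.

Hypothesis hT : is_lie_leibniz_triple rho T.

Lemma T_right_linear u : linear (T_right^~ u).
Proof.
apply: linB; first exact: lieb_linearl.
by apply: (linC (f := T)) => [|]; [exact: linearP|exact: rep_linearl].
Qed.

Lemma partial_T_partial_T m (theta : ('I_m -> V) -> g) :
  multilinear theta -> partial_T rho T (partial_T rho T theta) = 0.
Proof.
move=> hth; rewrite !partial_T_leib_d; apply: leib_d_d hth.
- by move=> u; exact: lieb_linearr.
- exact: T_right_linear.
- by move=> u v w; rewrite /T_br -hT rep_lieb subrK.
- by move=> u v x; rewrite /T_left /T_br -hT lieb_leibniz addrK.
- move=> u v x; rewrite /T_left /T_right /T_br -hT.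
  rewrite (lin_sub _ _ (lieb_linearr _)) lieb_leibniz hT.
  rewrite rep_lieb linearB /=.
  rewrite (hT u (rho x v)) opprB !addrA.
  by rewrite [RHS](ACl (1*4*3*(2*5))) /= subrr addr0.
(* Here [l u x + r x u = - T (rho x u)] lies in the image of [T], which [T_right] kills. *)
- move=> u v x; rewrite /T_left /T_right.
  rewrite [lieb x _]liebC addrA subrr sub0r.
  rewrite (lin_opp _ (lieb_linearl _)) hT.
  by rewrite (lin_opp _ (rep_linearl _ _)) linearN subrr.
Qed.

Lemma partial_T_Omega_T m (fg : ('I_m.+1 -> g) -> g) (fV : ('I_m -> g) -> V -> V) :
  multilinear fg -> alternating fg ->
  partial_T rho T (Omega_T T fg fV) = - Omega_T T (delta_g fg) (delta_V rho fg fV).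
Proof.
move=> hg ag; rewrite partial_T_leib_d.
(* The sign of [Omega_T] is built into [h]; [Omega_T] one degree higher carries one more factor -1,
   whence the minus in the statement. *)
pose h (X : g * V) : g := (-1) ^+ m.+1 *: (X.1 - T X.2).
pose phi (v : V) : g * V := (T v, v).
have hl : linear h.
  by apply: linZ; apply: linB => // a X Y; rewrite linearP.
apply/funext => u.
rewrite -[Omega_T T fg fV]/(fun v => h (hemi_cochain fg fV (fun i => phi (v i)))).
rewrite (@leib_d_natural _ _ _ _ _ hemi_br hemi_br hemi_br _ _ _ phi h) //.
- rewrite hemi_leib_d // [RHS]/GRing.opp /= /h /Omega_T.
  by rewrite [in RHS]exprS mulN1r scaleNr opprK.
- by move=> a b; rewrite /phi /T_br -hT.
- move=> a X; rewrite /h /T_left /= (lin_scale _ _ (lieb_linearr _)).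
  by rewrite (lin_sub _ _ (lieb_linearr _)) hT.
- move=> a X; rewrite /h (lin_scale _ _ (T_right_linear a)) /=.
  rewrite (lin_sub _ _ (T_right_linear a)); congr (_ *: _).
  by rewrite /T_right /= hT subrr subr0.
Qed.

End Triple.

(** * The three complexes and their short exact sequence *)

Section Complexes.
Variables (k : fieldType) (g : lieAlgType k) (V : lmodType k).
Variables (rho : lie_rep g V) (T : {linear V -> g}).

Lemma grho_is_complex : is_complex (grho_complex rho).
Proof.
move=> [|m] x /=; first by rewrite linear0.
case: x => fg fV; have [hg ag] := altHomP fg; have hV := altTensorHomP fV.
have [eg eV] := delta_delta rho hg ag hV.
by congr pair; apply: subm_inj.
Qed.

Hypothesis hT : is_lie_leibniz_triple rho T.

Lemma T_is_complex : is_complex (T_complex rho T).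
Proof.
move=> [|m] x /=; first by rewrite linear0.
by apply: subm_inj; exact: (partial_T_partial_T hT (tensorHomP x)).
Qed.

Lemma T_diff_Omega n (f : grho_complex rho n) :
  T_diff rho T n.+1 (Omega T n f) = - Omega T n.+1 (grho_diff rho n f).
Proof.
case: n f => [|m] f; first by rewrite /= !linear0.
have [hg ag] := altHomP (f : grhoC g V m).1.
by apply: subm_inj; exact: (partial_T_Omega_T hT _ hg ag).
Qed.

(** The second component of [D D (f, theta)] is [partial partial theta + partial Omega f + Omega
    delta f], and its last two terms cancel. *)
Lemma reg_is_complex : is_complex (reg_complex rho T).
Proof.
move=> n [f theta]; congr pair; first exact: grho_is_complex.
rewrite -[LHS]/(T_diff rho T n.+1 (T_diff rho T n theta + Omega T n f) +
  Omega T n.+1 (grho_diff rho n f)).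
rewrite linearD T_diff_Omega.
have -> : T_diff rho T n.+1 (T_diff rho T n theta) = 0 by exact: T_is_complex.
by rewrite add0r addNr.
Qed.

Lemma reg_short_exact : short_exact (reg_incl rho T) (reg_proj rho T).
Proof.
move=> n; split=> [x y [] //|[f theta]|f]; last by exists (f, 0).
by split=> [/= ->|[x <-]] //; exists theta.
Qed.

(** * The map induced by [Omega] on cohomology *)

Section Connecting.
Variable n : nat.

Fact Omega_cocycle_proof (f : cocycle (grho_complex rho) n) :
  Omega T n (subm_val f) \in
    submod_pred (Submodule (@cocycle_closed k (T_complex rho T) n.+1)).
Proof.
rewrite unfold_in; apply/eqP; rewrite [LHS]T_diff_Omega.
have -> : grho_diff rho n (subm_val f) = 0 by exact: (cocycleP f).
by rewrite linear0 oppr0.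
Qed.

Definition Omega_cocycle_fun (f : cocycle (grho_complex rho) n) :
  cocycle (T_complex rho T) n.+1 := Subm (Omega_cocycle_proof f).

Fact Omega_cocycle_linear : linear Omega_cocycle_fun.
Proof. by move=> a x y; apply: val_inj; rewrite /= linearP. Qed.
HB.instance Definition _ :=
  GRing.isLinear.Build k _ _ _ Omega_cocycle_fun Omega_cocycle_linear.

Definition Omega_cocycle :
  {linear cocycle (grho_complex rho) n -> cocycle (T_complex rho T) n.+1} :=
  Omega_cocycle_fun.

Fact Omega_cocycle_coboundary :
  {in submod_pred (Submodule (@coboundary_closed k (grho_complex rho) n)),
    forall z, Omega_cocycle z \in
      submod_pred (Submodule (@coboundary_closed k (T_complex rho T) n.+1))}.
Proof.
move=> z; rewrite !unfold_in => /asboolP hz; apply/asboolP => /=.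
move: (subm_val z) hz => {z}; case: n => [x ->|m x [y <-]].
  by exists 0; rewrite !linear0.
(* Anticommutation gives [Omega (delta y) = partial (- Omega y)]. *)
by exists (- Omega T m y); rewrite linearN [X in - X]T_diff_Omega opprK.
Qed.

Definition Omega_coh : {linear cohomology (grho_complex rho) n ->
    cohomology (T_complex rho T) n.+1} :=
  lquot_map Omega_cocycle_coboundary.

Lemma Omega_cohE f : Omega_coh (coh_class (grho_complex rho) n f) =
  coh_class (T_complex rho T) n.+1 (Omega_cocycle f).
Proof. exact: lquot_mapE. Qed.

End Connecting.

(* A lift of z is (z, theta), whose differential is
   (0, partial_T theta + Omega z). *)
Lemma Omega_coh_connecting :
  connecting (reg_incl rho T) (reg_proj rho T) Omega_coh.
Proof.
move=> n z [f theta] x /= ez ex; rewrite Omega_cohE; apply/coh_class_eq.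
have {}ex : subm_val x = T_diff rho T n theta + Omega T n f.
  exact: (congr1 snd ex).
by exists (- theta); rewrite ex /= -ez linearN opprD addrCA subrr addr0.
Qed.

End Complexes.

Theorem theorem5p6 (k : fieldType) (g : lieAlgType k) (V : lmodType k)
    (rho : lie_rep g V) (T : {linear V -> g})
    (hT : is_lie_leibniz_triple rho T) :
  [/\ is_complex (T_complex rho T),
      is_complex (reg_complex rho T),
      is_complex (grho_complex rho)
    & short_exact (reg_incl rho T) (reg_proj rho T)] /\
  exists c : forall n : nat,
      {linear cohomology (grho_complex rho) n -> cohomology (T_complex rho T) n.+1},
    [/\ long_exact (reg_incl rho T) (reg_proj rho T) c,
        connecting (reg_incl rho T) (reg_proj rho T) c
      & forall (n : nat) (f : cocycle (grho_complex rho) n),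
          exists w : cocycle (T_complex rho T) n.+1,
            subm_val w = Omega T n (subm_val f) /\
            c n (coh_class (grho_complex rho) n f) =
            coh_class (T_complex rho T) n.+1 w].
Proof.
have dD := reg_is_complex hT.
have ses := reg_short_exact rho T.
split; first by split=> //; [exact: T_is_complex|exact: grho_is_complex].
exists (Omega_coh hT); split.
- exact: (connecting_long_exact dD ses (@Omega_coh_connecting _ _ _ _ _ hT)).
- exact: Omega_coh_connecting.
- by move=> n f; exists (Omega_cocycle hT n f); split=> //; exact: Omega_cohE.
Qed.
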